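(* Let $(M,\langle\,,\rangle,\nabla f)$ be a conformally flat gradient Ricci almost soliton of dimension $m\ge3$ with soliton function $\lambda$ and scalar curvature $S$, and let $T=\mathrm{Ric}-\frac{S}{m}\langle\,,\rangle$ be the trace-free Ricci tensor. Then $$\frac12\Delta_f|T|^2=|\nabla T|^2+2\left(\lambda-S\frac{m-2}{m(m-1)}\right)|T|^2+(m-2)\langle\mathrm{Hess}(\lambda),T\rangle+\frac{4}{m-2}\mathrm{tr}(T^3),$$ with $T^3=T\circ T\circ T$. In particular, $$\frac12\Delta_f|T|^2\ge2\left(\lambda-S\frac{m-2}{m(m-1)}\right)|T|^2-\frac{4}{\sqrt{m(m-1)}}|T|^3+(m-2)\langle\mathrm{Hess}(\lambda),T\rangle.$$
   Context: For $f\in C^\infty(M)$, $(M,\langle\,,\rangle,\nabla f)$ is a gradient Ricci almost soliton with potential $f$ and soliton function $\lambda\in C^\infty(M)$ if $\mathrm{Ric}+\mathrm{Hess}(f)=\lambda\langle\,,\rangle$ on the Riemannian manifold $M$. $\Delta_fu=\Delta u-\langle\nabla f,\nabla u\rangle$. In $T^3$, $T$ is viewed as an endomorphism of $TM$ via the metric; inner products and norms of 2-tensors are those induced by the metric. *)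

(* Defs.v *)
From mathcomp Require Export all_boot all_order all_algebra.
From mathcomp Require Export all_classical all_reals all_analysis.
Export Order.TTheory GRing.Theory Num.Theory.
Export numFieldNormedType.Exports.

#[export] Set Implicit Arguments.
#[export] Unset Strict Implicit.
#[export] Unset Printing Implicit Defensive.

Local Open Scope classical_set_scope.
Local Open Scope ring_scope.

Section Calculus.
Context {R : realType} {m : nat}.
Implicit Types (i : 'I_m) (V : set 'rV[R]_m) (u : 'rV[R]_m -> R).

Definition partial i u (x : 'rV[R]_m) : R := 'D_(delta_mx 0 i) u x.

(* Meant for open V: the derivatives are those of the ambient space R^m. *)
Fixpoint Ck_on (k : nat) V u : Prop :=
  match k with
  | 0 => forall x, V x -> {for x, continuous u}
  | k'.+1 => (forall x, V x -> differentiable u x) /\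
             (forall i, Ck_on k' V (partial i u))
  end.

Definition smooth_on V u : Prop := forall k, Ck_on k V u.

End Calculus.

Section Charts.
Context (R : realType) (m : nat) (M : topologicalType).

(* chart_inv only matters on chart_img, and chart_map only on chart_dom. *)
Record chart := Chart {
  chart_dom : set M;
  chart_map : M -> 'rV[R]_m;
  chart_inv : 'rV[R]_m -> M;
  chart_img := chart_map @` chart_dom;
  chart_dom_open : open chart_dom;
  chart_img_open : open chart_img;
  chart_mapK : forall p, chart_dom p -> chart_inv (chart_map p) = p;
  chart_map_continuous : forall p, chart_dom p -> {for p, continuous chart_map};
  chart_inv_continuous : forall x, chart_img x -> {for x, continuous chart_inv}
}.

Definition transition (c d : chart) : 'rV[R]_m -> 'rV[R]_m :=
  chart_map d \o chart_inv c.

Definition overlap (c d : chart) : set 'rV[R]_m :=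
  chart_map c @` (chart_dom c `&` chart_dom d).

End Charts.

(* The atlas need not be maximal: it determines the smooth structure. *)
Record smoothManifold (R : realType) (m : nat) := SmoothManifold {
  carrier :> topologicalType;
  atlas : set (chart R m carrier);
  manifold_hausdorff : hausdorff_space carrier;
  manifold_second_countable : @second_countable carrier;
  atlas_cover : forall p : carrier, exists2 c, atlas c & chart_dom c p;
  atlas_compatible : forall c d, atlas c -> atlas d ->
    forall j : 'I_m, smooth_on (overlap c d) (fun x => transition c d x 0 j)
}.

Section OnManifolds.
Context (R : realType) (m : nat) (M : smoothManifold R m).

Definition smooth_fun_on (U : set M) (u : M -> R) : Prop :=
  forall c, atlas c ->
    smooth_on (chart_map c @` (chart_dom c `&` U)) (u \o chart_inv c).

Definition smooth_fun (u : M -> R) : Prop := smooth_fun_on setT u.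

(* A metric is given by its components g_ij in each chart, as functions of the
   coordinates. Tangent vectors are row vectors, so the differential of a
   transition map tau is v |-> v *m 'J tau x. *)
Record riemannianMetric := RiemannianMetric {
  metric_coord :> chart R m M -> 'rV[R]_m -> 'M[R]_m;
  metric_sym : forall c, atlas c -> forall x, chart_img c x ->
    (metric_coord c x)^T = metric_coord c x;
  metric_posdef : forall c, atlas c -> forall x, chart_img c x ->
    forall v : 'rV[R]_m, v != 0 -> 0 < (v *m metric_coord c x *m v^T) 0 0;
  metric_smooth : forall c, atlas c -> forall i j,
    smooth_on (chart_img c) (fun x => metric_coord c x i j);
  metric_transform : forall c d, atlas c -> atlas d ->
    forall x, overlap c d x ->
      metric_coord c x =
        'J (transition c d) x *m metric_coord d (transition c d x)
          *m ('J (transition c d) x)^T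
}.

End OnManifolds.

(* Riemannian geometry in coordinates: G is the matrix of components g_ij, and
   a covariant 2-tensor field is given by its matrix of components. *)
Section CoordinateGeometry.
Context {R : realType} {m : nat}.
Variable G : 'rV[R]_m -> 'M[R]_m.
Implicit Types (i j k l : 'I_m) (x : 'rV[R]_m) (u f : 'rV[R]_m -> R).
Implicit Types (A B : 'M[R]_m) (T : 'rV[R]_m -> 'M[R]_m).

(* Gamma^k_ij *)
Definition christoffel k i j x : R :=
  2^-1 * \sum_l invmx (G x) k l *
    (partial i (fun y => G y j l) x + partial j (fun y => G y i l) x
     - partial l (fun y => G y i j) x).

(* the component R^l_ijk, where R(d_i, d_j) d_k = sum_l R^l_ijk d_l and
   R(X, Y) Z = D_X D_Y Z - D_Y D_X Z - D_[X,Y] Z *)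
Definition riemann l i j k x : R :=
  partial i (christoffel l j k) x - partial j (christoffel l i k) x
  + \sum_p (christoffel p j k x * christoffel l i p x
            - christoffel p i k x * christoffel l j p x).

Definition ricci x : 'M[R]_m := \matrix_(j, k) \sum_i riemann i i j k x.

Definition metric_trace x A : R := \sum_i \sum_j invmx (G x) i j * A i j.

Definition scalar_curvature x : R := metric_trace x (ricci x).

Definition hessian u x : 'M[R]_m := \matrix_(i, j)
  (partial i (partial j u) x - \sum_k christoffel k i j x * partial k u x).

Definition laplacian u x : R := metric_trace x (hessian u x).

Definition gradient u x : 'rV[R]_m := (\row_i partial i u x) *m invmx (G x).

Definition inner_vec x (v w : 'rV[R]_m) : R := (v *m G x *m w^T) 0 0.

Definition drift_laplacian f u x : R :=
  laplacian u x - inner_vec x (gradient f x) (gradient u x).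

Definition inner_tensor x A B : R :=
  \sum_i \sum_j \sum_k \sum_l
    invmx (G x) i k * invmx (G x) j l * A i j * B k l.

Definition sqnorm_tensor x A : R := inner_tensor x A A.

Definition norm_tensor x A : R := Num.sqrt (sqnorm_tensor x A).

(* components of D_(d_k) T *)
Definition cov_deriv k T x : 'M[R]_m := \matrix_(i, j)
  (partial k (fun y => T y i j) x
   - \sum_p (christoffel p k i x * T x p j + christoffel p k j x * T x i p)).

Definition sqnorm_cov_deriv T x : R :=
  \sum_k \sum_l invmx (G x) k l *
    inner_tensor x (cov_deriv k T x) (cov_deriv l T x).

(* the endomorphism g^(i k) A_kj associated with A by the metric *)
Definition endo x A : 'M[R]_m := invmx (G x) *m A.

Definition trace_cube x A : R := \tr (endo x A *m endo x A *m endo x A).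

Definition tracefree_ricci x : 'M[R]_m :=
  ricci x - (scalar_curvature x / m%:R) *: G x.

End CoordinateGeometry.

Section Notions.
Context (R : realType) (m : nat) (M : smoothManifold R m).
Variable g : riemannianMetric M.

(* Every point has a neighbourhood U carrying a smooth function u such that the
   curvature tensor of exp(2u) g vanishes on U. *)
Definition conformally_flat : Prop :=
  forall p : M, exists (U : set M) (u : M -> R),
    [/\ open U, U p, smooth_fun_on U u &
        forall c, atlas c ->
        forall x, (chart_map c @` (chart_dom c `&` U)) x ->
        forall l i j k,
          riemann (fun y => expR (2 * u (chart_inv c y)) *: g c y) l i j k x
          = 0].

Definition gradient_ricci_almost_soliton (f lambda : M -> R) : Prop :=
  [/\ smooth_fun f, smooth_fun lambda &
      forall c, atlas c -> forall x, chart_img c x ->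
        ricci (g c) x + hessian (g c) (f \o chart_inv c) x
        = lambda (chart_inv c x) *: g c x].

End Notions.

(* Main.v *)
From HB Require Import structures.
Require Import Defs.
From mathcomp Require Import ring lra.
Local Open Scope ring_scope.

(** Why the theorem holds. Write [G] for the metric, [v] for the gradient of the
    potential, [D] for the Levi-Civita connection, [n] for the dimension, and
    use the metric to regard symmetric 2-tensors as self-adjoint endomorphisms.

    Near a given point let exp(2u) [G] be flat. The formula for the curvature of
    a conformal metric turns flatness into an expression of the curvature of [G]
    by the endomorphism [P = Hess u - grad u (x) du + |du|^2 / 2]: the curvature
    operator of the pair (X, Y) is W P + P W, where W is the rank two
    skew-adjoint endomorphism attached to (X, Y) ([conformal_schouten_curv]).
    Thus [P] is the Schouten endomorphism and, with [a = tr P], the Ricci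
    endomorphism is [(n - 2) P + a] ([ricci_mx_schouten]). Moreover
    [(D_X P) Y] is symmetric in X and Y ([conformal_schouten_codazzi]): the skew
    part of [(D_X Hess u) Y] is the curvature applied to grad u, and it is
    cancelled by the derivatives of the two quadratic terms of [P].

    The soliton equation now reads [Hess f = b - (n - 2) P] with
    [b = lambda - a]. Skew-symmetrizing the derivative of this endomorphism
    makes the terms in [P] disappear and leaves
    [R(X, Y) v = (X b) Y - (Y b) X] ([soliton_curv]). Contracting this with the
    identity and with [P] gives two identities between vector fields
    ([soliton_gradient]):
      [(n - 1) grad b = - (n - 2) P v - a v],
      [a grad b - P grad b = (2 P^2 - a P - tr P^2) v].
    Their divergences, and the trace of [P] against the differential of the
    first, are three scalar equations ([soliton_lapl], [soliton_trace_hess],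
    [soliton_div]). The commutation rule for second derivatives gives a fourth
    one, for [tr (P (rough Laplacian of P))] ([trace_mul_rough_lapl]). Since the
    trace-free Ricci endomorphism is [T = (n - 2) (P - a / n)], Bochner's formula
    for [tr T^2] ([bochner_affine]) combined with these four equations is the
    asserted identity; only scalar algebra remains ([soliton_scalar_identity]).

    The inequality follows by dropping [|D T|^2 >= 0] and by Okumura's estimate
    [tr T^3 >= - (n - 2) / sqrt (n (n - 1)) |T|^3] ([okumura]): for suitable
    [al, be >= 0], both multiples of [|T|], the trace of [(T - al)^2 (T + be)] is
    nonnegative because [T + be] is, by the Cauchy-Schwarz inequality.

    To make all this algebra, the smooth functions on an open subset [V] of
    R^m are organized as a commutative ring with commuting derivations
    ([smooth_derivations]; commutation is Schwarz's theorem
    [mixed_derivatives_commute]). Metric, inverse metric and Christoffel symbols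
    become matrices over that ring, the connection becomes a derivation of the
    matrix ring, and evaluation at a point is a ring morphism carrying the
    abstract objects to the coordinate expressions of the theorem. *)

(** * Commuting derivations and matrices *)

Record derivations (A : comNzRingType) (m : nat) := Derivations {
  der :> 'I_m -> A -> A;
  derD : forall i x y, der i (x + y) = der i x + der i y;
  derM : forall i x y, der i (x * y) = der i x * y + x * der i y;
  derC : forall i j x, der i (der j x) = der j (der i x)
}.

(** With [mx_linE] only the linear structure of a matrix is opened up, so that
    the entries of products stay atoms for [ring]; this is what makes [mxring]
    decide identities between noncommuting matrix monomials. *)
Lemma mxE_add (A : nmodType) p q (X Y : 'M[A]_(p, q)) i j :
  (X + Y) i j = X i j + Y i j.
Proof. by rewrite mxE. Qed.

Lemma mxE_opp (A : zmodType) p q (X : 'M[A]_(p, q)) i j : (- X) i j = - X i j.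
Proof. by rewrite mxE. Qed.

Lemma mxE_scale (A : pzRingType) p q (a : A) (X : 'M[A]_(p, q)) i j :
  (a *: X) i j = a * X i j.
Proof. by rewrite mxE. Qed.

Definition mx_linE := (mxE_add, mxE_opp, mxE_scale).

Ltac mxring :=
  let p := fresh "p" in let q := fresh "q" in
  apply/matrixP => p q;
  rewrite ?(mulmxDl, mulmxDr, mulmxN, mulNmx, mulmxA, mul1mx, mulmx1,
            =^~ scalemxAl, =^~ scalemxAr) ?mx_linE; ring.

Section Derivations.
Context {A : comNzRingType} {m : nat} (d : derivations A m).
Implicit Types (i j k : 'I_m).

Lemma der0 i : d i 0 = 0.
Proof. by apply: (addrI (d i 0)); rewrite -derD !addr0. Qed.

Lemma derN i x : d i (- x) = - d i x.
Proof. by apply: (addrI (d i x)); rewrite -derD !subrr der0. Qed.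

Lemma derB i x y : d i (x - y) = d i x - d i y.
Proof. by rewrite derD derN. Qed.

Lemma der1 i : d i 1 = 0.
Proof.
by apply: (addrI (d i 1)); rewrite addr0 -[in RHS](mulr1 1) derM mulr1 mul1r.
Qed.

Lemma der_nat i n : d i n%:R = 0.
Proof. by elim: n => [|n IH]; rewrite ?der0 // -natr1 derD IH der1 addr0. Qed.

Lemma der_inv_nat i n x : x * n%:R = 1 -> d i x = 0.
Proof.
move=> xn; have := congr1 (d i) xn; rewrite derM der_nat mulr0 addr0 der1.
by move/(congr1 ( *%R^~ x)); rewrite mul0r -mulrA [n%:R * x]mulrC xn mulr1.
Qed.

Lemma der_sum i I (r : seq I) (P : pred I) F :
  d i (\sum_(a <- r | P a) F a) = \sum_(a <- r | P a) d i (F a).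
Proof. by apply: (big_morph (d i) (derD d i) (der0 i)). Qed.

Definition dmx p q i (X : 'M[A]_(p, q)) : 'M[A]_(p, q) := map_mx (d i) X.

Lemma dmxD p q i (X Y : 'M[A]_(p, q)) : dmx i (X + Y) = dmx i X + dmx i Y.
Proof. by apply/matrixP => a b; rewrite !mxE derD. Qed.

Lemma dmxN p q i (X : 'M[A]_(p, q)) : dmx i (- X) = - dmx i X.
Proof. by apply/matrixP => a b; rewrite !mxE derN. Qed.

Lemma dmxZ p q i (x : A) (X : 'M[A]_(p, q)) :
  dmx i (x *: X) = d i x *: X + x *: dmx i X.
Proof. by apply/matrixP => a b; rewrite !mxE derM. Qed.

Lemma dmxM p q r i (X : 'M[A]_(p, q)) (Y : 'M[A]_(q, r)) :
  dmx i (X *m Y) = dmx i X *m Y + X *m dmx i Y.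
Proof.
apply/matrixP => a b; rewrite !mxE der_sum -big_split; apply: eq_bigr => c _.
by rewrite derM !mxE.
Qed.

Lemma dmxT p q i (X : 'M[A]_(p, q)) : dmx i X^T = (dmx i X)^T.
Proof. by apply/matrixP => a b; rewrite !mxE. Qed.

Lemma dmx1 i : dmx i (1%:M : 'M[A]_m) = 0.
Proof. by apply/matrixP => a b; rewrite !mxE der_nat. Qed.

Lemma dmx_delta p q i a b : dmx i (delta_mx a b : 'M[A]_(p, q)) = 0.
Proof. by apply/matrixP => a' b'; rewrite !mxE der_nat. Qed.

Lemma dmxC p q i j (X : 'M[A]_(p, q)) : dmx i (dmx j X) = dmx j (dmx i X).
Proof. by apply/matrixP => a b; rewrite !mxE derC. Qed.

Lemma der_trace i (P : 'M[A]_m) : d i (\tr P) = \tr (dmx i P).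
Proof. by rewrite /mxtrace der_sum; apply: eq_bigr => a _; rewrite mxE. Qed.

End Derivations.

Lemma mulmx_delta (A : comNzRingType) p q (X : 'M[A]_(p, q)) i j :
  (X *m (delta_mx j 0 : 'cV_q)) i 0 = X i j.
Proof. by rewrite -colE mxE. Qed.

Lemma mulmx_col_sum (A : comNzRingType) p q (X : 'M[A]_(p, q)) (Z : 'cV[A]_q) :
  X *m Z = \sum_k Z k 0 *: (X *m delta_mx k 0).
Proof.
apply/matrixP => i j; rewrite ord1 mxE summxE; apply: eq_bigr => k _.
by rewrite mxE mulmx_delta mulrC.
Qed.

Lemma rank1_mul (A : comNzRingType) p q r (x : 'cV[A]_p) (y : 'rV[A]_q)
    (z : 'M[A]_(q, 1)) (t : 'M[A]_(1, r)) :
  x *m y *m z *m t = (y *m z) 0 0 *: (x *m t).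
Proof.
rewrite -[x *m y *m z]mulmxA [y *m z]mx11_scalar mul_mx_scalar.
by rewrite -scalemxAl !mxE eqxx mulr1n.
Qed.

(** * Connections *)

Section Connection.
Context {A : comNzRingType} {m : nat} (d : derivations A m).
Context (C : 'I_m -> 'M[A]_m).
Implicit Types (i j k : 'I_m) (P Q : 'M[A]_m).
Local Notation e j := (delta_mx j 0 : 'cV[A]_m).
Local Notation dmx := (dmx d).

(** [C i] is the matrix of the connection in direction i: its entry (l, j) is the
    Christoffel symbol with upper index l and lower indices i, j. Columns are
    vector fields and square matrices are endomorphism fields; the direction i
    is not treated as a tensor index, so [cov_end] is a derivation of the matrix
    ring. *)
Definition cov_vec p i (X : 'M[A]_(m, p)) := dmx i X + C i *m X.
Definition cov_end i P := dmx i P + C i *m P - P *m C i.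
Definition curv i j := dmx i (C j) - dmx j (C i) + C i *m C j - C j *m C i.

Lemma cov_vecD p i (X Y : 'M[A]_(m, p)) : cov_vec i (X + Y) = cov_vec i X + cov_vec i Y.
Proof. by rewrite /cov_vec dmxD mulmxDr addrACA. Qed.

Lemma cov_vecN p i (X : 'M[A]_(m, p)) : cov_vec i (- X) = - cov_vec i X.
Proof. by rewrite /cov_vec dmxN mulmxN opprD. Qed.

Lemma cov_vecZ p i x (X : 'M[A]_(m, p)) :
  cov_vec i (x *: X) = d i x *: X + x *: cov_vec i X.
Proof. by rewrite /cov_vec dmxZ -scalemxAr scalerDr addrA. Qed.

Lemma cov_vecM p i P (X : 'M[A]_(m, p)) :
  cov_vec i (P *m X) = cov_end i P *m X + P *m cov_vec i X.
Proof. rewrite /cov_vec /cov_end dmxM; mxring. Qed.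

Lemma cov_vec_delta i j : cov_vec i (e j) = C i *m e j.
Proof. by rewrite /cov_vec dmx_delta add0r. Qed.

Lemma cov_endD i P Q : cov_end i (P + Q) = cov_end i P + cov_end i Q.
Proof. rewrite /cov_end dmxD; mxring. Qed.

Lemma cov_endN i P : cov_end i (- P) = - cov_end i P.
Proof. rewrite /cov_end dmxN; mxring. Qed.

Lemma cov_endZ i x P : cov_end i (x *: P) = d i x *: P + x *: cov_end i P.
Proof. rewrite /cov_end dmxZ; mxring. Qed.

Lemma cov_end1 i : cov_end i 1%:M = 0.
Proof. by rewrite /cov_end dmx1 mulmx1 mul1mx add0r subrr. Qed.

Lemma cov_endM i P Q : cov_end i (P *m Q) = cov_end i P *m Q + P *m cov_end i Q.
Proof. rewrite /cov_end dmxM; mxring. Qed.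

Lemma trace_cov_end i P : \tr (cov_end i P) = d i (\tr P).
Proof.
by rewrite /cov_end raddfB raddfD /= [\tr (C i *m P)]mxtrace_mulC addrK der_trace.
Qed.

Lemma ricci_identity p i j (X : 'M[A]_(m, p)) :
  cov_vec i (cov_vec j X) - cov_vec j (cov_vec i X) = curv i j *m X.
Proof.
rewrite /cov_vec /curv !dmxD !dmxM (dmxC d i j); mxring.
Qed.

Lemma ricci_identity_endo i j P :
  cov_end i (cov_end j P) - cov_end j (cov_end i P) = curv i j *m P - P *m curv i j.
Proof.
rewrite /cov_end /curv !(dmxD, dmxN, dmxM) (dmxC d i j); mxring.
Qed.

Hypothesis torsion_free : forall i j, C i *m e j = C j *m e i.

(** If [P] is the covariant differential of [w], then the skew part of its own
    differential is the commutator of second derivatives of [w]; the terms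
    differentiating the coordinate vectors cancel because the torsion is zero. *)
Lemma cov_vec_hessian_curv w P : (forall i, cov_vec i w = P *m e i) ->
  forall i j, cov_end i P *m e j - cov_end j P *m e i = curv i j *m w.
Proof.
move=> wP i j; rewrite -ricci_identity !wP !cov_vecM !cov_vec_delta (torsion_free i j).
mxring.
Qed.

End Connection.

(** * Levi-Civita connections *)

Record levi_civita (A : comNzRingType) (m : nat) (d : derivations A m)
    (g h : 'M[A]_m) (C : 'I_m -> 'M[A]_m) : Prop := LeviCivita {
  lc_sym : g^T = g;
  lc_inv : h *m g = 1%:M;
  lc_torsion : forall i j,
    C i *m delta_mx j 0 = C j *m delta_mx i 0 :> 'cV[A]_m;
  lc_compat : forall i, dmx d i g = (C i)^T *m g + g *m C i
}.

Section LeviCivita.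
Context {A : comNzRingType} {m : nat} {d : derivations A m}.
Context {g h : 'M[A]_m} {C : 'I_m -> 'M[A]_m} (lc : levi_civita d g h C).
Implicit Types (i j k : 'I_m) (P Q X : 'M[A]_m) (u : A).
Local Notation e j := (delta_mx j 0 : 'cV[A]_m).
Local Notation cov_vec := (cov_vec d C).
Local Notation cov_end := (cov_end d C).
Local Notation curv := (curv d C).

Lemma lc_invr : g *m h = 1%:M.
Proof. exact: mulmx1C (lc_inv lc). Qed.

Lemma lc_inv_sym : h^T = h.
Proof.
have hg : h^T *m g = 1%:M by rewrite -{1}(lc_sym lc) -trmx_mul lc_invr trmx1.
by rewrite -[h^T]mulmx1 -lc_invr mulmxA hg mul1mx.
Qed.

Lemma lowerK p (X : 'M[A]_(m, p)) : h *m (g *m X) = X.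
Proof. by rewrite mulmxA (lc_inv lc) mul1mx. Qed.

Lemma raiseK p (X : 'M[A]_(m, p)) : g *m (h *m X) = X.
Proof. by rewrite mulmxA lc_invr mul1mx. Qed.

Lemma torsion_entry i j k : C i k j = C j k i.
Proof. by have /matrixP/(_ k 0) := lc_torsion lc i j; rewrite !mulmx_delta. Qed.

Lemma lower_cov_vec p i (X : 'M[A]_(m, p)) :
  g *m cov_vec i X = dmx d i (g *m X) - (C i)^T *m (g *m X).
Proof. rewrite dmxM (lc_compat lc) /cov_vec; mxring. Qed.

Lemma dmx_inv i : dmx d i h = - (C i *m h) - h *m (C i)^T.
Proof.
have := congr1 (dmx d i) lc_invr; rewrite dmxM dmx1 (lc_compat lc).
rewrite mulmxDl -!mulmxA lc_invr mulmx1 => /(congr1 (mulmx h)).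
rewrite mulmx0 !mulmxDr !lowerK => eq0.
apply/eqP; rewrite -subr_eq0 -eq0; apply/eqP; mxring.
Qed.

(** Self-adjointness for g amounts to symmetry of the lowered tensor, since g is
    symmetric. *)
Definition selfadj X := X^T *m g = g *m X.

Lemma selfadj1 : selfadj 1%:M.
Proof. by rewrite /selfadj trmx1 mul1mx mulmx1. Qed.

Lemma selfadj_raise X : selfadj X -> h *m X^T = X *m h.
Proof.
move=> sX; rewrite -[h *m X^T]mulmx1 -lc_invr -[h *m _ *m _]mulmxA.
by rewrite [X^T *m _]mulmxA sX -mulmxA lowerK.
Qed.

Lemma selfadjD X Q : selfadj X -> selfadj Q -> selfadj (X + Q).
Proof. by rewrite /selfadj linearD mulmxDl mulmxDr => -> ->. Qed.

Lemma selfadjZ x X : selfadj X -> selfadj (x *: X).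
Proof. by rewrite /selfadj linearZ /= -scalemxAl -scalemxAr => ->. Qed.

Lemma selfadjN X : selfadj X -> selfadj (- X).
Proof. by rewrite -scaleN1r; apply: selfadjZ. Qed.

Lemma selfadj_sq X : selfadj X -> selfadj (X *m X).
Proof. by rewrite /selfadj trmx_mul -mulmxA => sX; rewrite sX !mulmxA sX. Qed.

Lemma selfadj_cov_end i X : selfadj X -> selfadj (cov_end i X).
Proof.
move=> sX; have := congr1 (dmx d i) sX.
rewrite !dmxM (lc_compat lc) dmxT mulmxDr mulmxDl /selfadj /cov_end => eqd.
have sCX : (C i)^T *m X^T *m g = (C i)^T *m g *m X.
  by rewrite -mulmxA sX mulmxA.
have sXC : X^T *m g *m C i = g *m X *m C i by rewrite sX.
rewrite linearB linearD /= !trmx_mul.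
move: eqd; rewrite !mulmxA sXC => /eqP; rewrite -subr_eq0 => /eqP eqd.
apply/eqP; rewrite -subr_eq0 -eqd !(mulmxDl, mulNmx) sCX; apply/eqP; mxring.
Qed.

(** ** Gradients and Hessians *)

Definition dcol u : 'cV[A]_m := \col_l d l u.
Definition grad u : 'cV[A]_m := h *m dcol u.
Definition hess u : 'M[A]_m :=
  \matrix_(i, j) (d i (d j u) - \sum_k C i k j * d k u).
(** The Hessian with its first index raised: the covariant differential of the
    gradient, see [cov_vec_grad]. *)
Definition hessend u : 'M[A]_m := h *m hess u.
Definition lapl u : A := \tr (hessend u).

Lemma hess_sym u : (hess u)^T = hess u.
Proof.
apply/matrixP => i j; rewrite !mxE derC; congr (_ - _).
by apply: eq_bigr => k _; rewrite torsion_entry.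
Qed.

Lemma cov_vec_grad u i : cov_vec i (grad u) = hessend u *m e i.
Proof.
rewrite /hessend -[cov_vec _ _]lowerK lower_cov_vec raiseK -mulmxA; congr (h *m _).
apply/matrixP => l z; rewrite ord1 mulmx_delta -[in RHS]hess_sym !mxE.
by congr (_ - _); apply: eq_bigr => k _; rewrite !mxE.
Qed.

Lemma selfadj_hessend u : selfadj (hessend u).
Proof.
rewrite /selfadj /hessend trmx_mul hess_sym lc_inv_sym -mulmxA (lc_inv lc).
by rewrite mulmx1 mulmxA lc_invr mul1mx.
Qed.

Lemma laplE u :
  lapl u = \sum_i \sum_k h i k * (d i (d k u) - \sum_p C i p k * d p u).
Proof.
rewrite /lapl /mxtrace; apply: eq_bigr => i _; rewrite mxE.
by apply: eq_bigr => k _; rewrite -(hess_sym u) !mxE.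
Qed.

Definition along (Y : 'cV[A]_m) u : A := \sum_i Y i 0 * d i u.

(** The trace of [P] times the covariant differential of [Y]; at [P = 1] this is
    the divergence of [Y]. *)
Definition trdiv P (Y : 'cV[A]_m) : A := \sum_i (P *m cov_vec i Y) i 0.

Lemma trdivD P (Y Z : 'cV[A]_m) : trdiv P (Y + Z) = trdiv P Y + trdiv P Z.
Proof.
by rewrite /trdiv -big_split; apply: eq_bigr => i _; rewrite cov_vecD mulmxDr mxE.
Qed.

Lemma trdivN P (Y : 'cV[A]_m) : trdiv P (- Y) = - trdiv P Y.
Proof.
by rewrite /trdiv -sumrN; apply: eq_bigr => i _; rewrite cov_vecN mulmxN mxE.
Qed.

Lemma trdivZ P x (Y : 'cV[A]_m) :
  trdiv P (x *: Y) = along (P *m Y) x + x * trdiv P Y.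
Proof.
rewrite /trdiv mulr_sumr -big_split; apply: eq_bigr => i _.
by rewrite cov_vecZ mulmxDr -!scalemxAr !mxE_add !mxE_scale mulrC.
Qed.

Lemma trdiv_endo P Q (Y : 'cV[A]_m) : (forall i, cov_vec i Y = Q *m e i) ->
  trdiv P Y = \tr (P *m Q).
Proof.
move=> YQ; rewrite /mxtrace /trdiv; apply: eq_bigr => i _.
by rewrite YQ mulmxA mulmx_delta.
Qed.

Lemma trdiv_mul P Q (Y : 'cV[A]_m) :
  trdiv P (Q *m Y) = \sum_i (P *m cov_end i Q *m Y) i 0 + trdiv (P *m Q) Y.
Proof.
rewrite /trdiv -big_split; apply: eq_bigr => i _.
by rewrite cov_vecM mulmxDr !mulmxA mxE.
Qed.

(** ** Codazzi endomorphisms *)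

Definition codazzi P := forall i j, cov_end i P *m e j = cov_end j P *m e i.

Definition cov_end_along (Y : 'cV[A]_m) P : 'M[A]_m := \sum_i Y i 0 *: cov_end i P.

Lemma codazzi_mul P (Y : 'cV[A]_m) i : codazzi P ->
  cov_end i P *m Y = cov_end_along Y P *m e i.
Proof.
move=> cP; rewrite mulmx_col_sum /cov_end_along mulmx_suml; apply: eq_bigr => k _.
by rewrite -scalemxAl cP.
Qed.

Lemma trace_cov_end_along (Y : 'cV[A]_m) P :
  \tr (cov_end_along Y P) = along Y (\tr P).
Proof.
rewrite /cov_end_along linear_sum; apply: eq_bigr => i _.
by rewrite linearZ /= trace_cov_end.
Qed.

(** The Codazzi equation moves the derivation index onto the trace, so a
    divergence of [P] becomes a derivative of [P] along [Y]. *)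
Lemma codazzi_div P Q (Y : 'cV[A]_m) : codazzi P ->
  \sum_i (Q *m cov_end i P *m Y) i 0 = \tr (Q *m cov_end_along Y P).
Proof.
move=> cP; apply: eq_bigr => i _.
by rewrite -mulmxA codazzi_mul // mulmxA mulmx_delta.
Qed.

Lemma along_trace_sq (Y : 'cV[A]_m) P :
  along Y (\tr (P *m P)) = 2 * \tr (P *m cov_end_along Y P).
Proof.
rewrite /along /cov_end_along mulmx_sumr linear_sum mulr_sumr /=.
apply: eq_bigr => i _; rewrite -(trace_cov_end d C) cov_endM linearD /=.
rewrite [\tr (cov_end i P *m P)]mxtrace_mulC -scalemxAr linearZ /=; ring.
Qed.

(** The second covariant derivative. The Christoffel term accounts for k being a
    tensor index, which the iterated [cov_end] ignores. *)
Definition cov2 i k P : 'M[A]_m :=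
  cov_end i (cov_end k P) - \sum_p C i p k *: cov_end p P.

Definition rough_lapl P : 'M[A]_m := \sum_i \sum_k h i k *: cov2 i k P.

Lemma cov2_comm i j P :
  cov2 i j P - cov2 j i P = curv i j *m P - P *m curv i j.
Proof.
rewrite -ricci_identity_endo /cov2.
rewrite (eq_bigr (fun p => C j p i *: cov_end p P)) => [|p _].
  by rewrite opprB addrA subrK.
by rewrite torsion_entry.
Qed.

Lemma col_mulmx_delta P Q j :
  P *m Q *m e j = \sum_p Q p j *: (P *m e p).
Proof.
rewrite -mulmxA mulmx_col_sum; apply: eq_bigr => p _.
by rewrite mulmx_delta.
Qed.

(** The Codazzi equation, differentiated once more. *)
Lemma codazzi_cov2 P i j k : codazzi P -> cov2 i k P *m e j = cov2 i j P *m e k.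
Proof.
move=> cP; rewrite /cov2 !(mulmxBl (cov_end i _)) !mulmx_suml.
have covd a b : cov_end i (cov_end a P) *m e b
    = cov_vec i (cov_end a P *m e b) - cov_end a P *m C i *m e b.
  by rewrite cov_vecM cov_vec_delta mulmxA addrK.
rewrite !covd (cP k j) !col_mulmx_delta.
have -> : \sum_p C i p j *: (cov_end k P *m e p) = \sum_p C i p j *: cov_end p P *m e k.
  by apply: eq_bigr => p _; rewrite -scalemxAl cP.
have -> : \sum_p C i p k *: (cov_end j P *m e p) = \sum_p C i p k *: cov_end p P *m e j.
  by apply: eq_bigr => p _; rewrite -scalemxAl cP.
by rewrite addrAC.
Qed.

(** Lowering the index, each summand becomes the transpose of a derivative of
    [P] applied to a coordinate vector; the Codazzi equation turns the sum into
    the trace of a single derivative. *)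
Lemma codazzi_div_grad P : codazzi P -> selfadj P ->
  \sum_i cov_end i P *m h *m e i = grad (\tr P).
Proof.
move=> cP sP; rewrite -[LHS]lowerK /grad; congr (h *m _).
apply/matrixP => l z; rewrite ord1 mulmx_sumr summxE mxE -(trace_cov_end d C).
apply: eq_bigr => i _.
have -> : g *m (cov_end i P *m h *m e i) = (cov_end i P)^T *m e i.
  by rewrite !mulmxA -(selfadj_cov_end i sP) -[_ *m g *m h]mulmxA lc_invr mulmx1.
rewrite mulmx_delta mxE -mulmx_delta cP mulmx_delta; done.
Qed.

(** By the Codazzi equation the Laplacian is a divergence in which the two
    derivation indices can be exchanged at the cost of curvature; what is left
    is the differential of the divergence of [P], i.e. the Hessian of its
    trace. *)
Lemma codazzi_rough_lapl P : codazzi P -> selfadj P -> forall j,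
  rough_lapl P *m e j = hessend (\tr P) *m e j
    + \sum_i (curv i j *m P - P *m curv i j) *m h *m e i.
Proof.
move=> cP sP j.
rewrite -cov_vec_grad -codazzi_div_grad //.
have -> : rough_lapl P *m e j = \sum_i cov2 i j P *m h *m e i.
  rewrite /rough_lapl mulmx_suml; apply: eq_bigr => i _.
  rewrite mulmx_suml -mulmxA [RHS]mulmx_col_sum; apply: eq_bigr => k _.
  by rewrite -scalemxAl (codazzi_cov2 i j k cP) mulmx_delta -{1}lc_inv_sym mxE.
under eq_bigr => i _ do rewrite -(subrK (cov2 j i P) (cov2 i j P)) cov2_comm.
under eq_bigr => i _ do rewrite 2!mulmxDl.
rewrite big_split addrC /=; congr (_ + _).
have cov_vec_sum I (r : seq I) (F : I -> 'cV[A]_m) :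
    cov_vec j (\sum_(a <- r) F a) = \sum_(a <- r) cov_vec j (F a).
  apply: (big_morph (cov_vec j) (cov_vecD _ _ j)).
  by rewrite /cov_vec mulmx0 addr0; apply/matrixP => a b; rewrite !mxE der0.
rewrite cov_vec_sum.
have -> : \sum_i cov_vec j (cov_end i P *m h *m e i)
    = \sum_i cov_end j (cov_end i P) *m h *m e i
      - \sum_i cov_end i P *m h *m (C j)^T *m e i.
  rewrite -sumrB; apply: eq_bigr => i _; rewrite -mulmxA cov_vecM.
  rewrite /cov_vec dmxM dmx_inv dmx_delta mulmx0 addr0; mxring.
under eq_bigr => i _ do rewrite /cov2 2!mulmxBl.
rewrite sumrB; congr (_ - _).
under eq_bigr => i _ do rewrite !mulmx_suml.
rewrite exchange_big; apply: eq_bigr => i _ /=.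
rewrite col_mulmx_delta; apply: eq_bigr => p _.
by rewrite -!scalemxAl mxE.
Qed.

Lemma half_lapl_trace_sq P (half : A) : half * 2 = 1 ->
  half * lapl (\tr (P *m P))
    = \sum_i \sum_k h i k * \tr (cov_end i P *m cov_end k P) + \tr (P *m rough_lapl P).
Proof.
move=> half2; rewrite laplE mulr_sumr /rough_lapl mulmx_sumr linear_sum.
rewrite -big_split; apply: eq_bigr => i _ /=; rewrite mulr_sumr.
rewrite mulmx_sumr linear_sum -big_split; apply: eq_bigr => k _ /=.
have d1 p : d p (\tr (P *m P)) = 2 * \tr (P *m cov_end p P).
  by rewrite -(trace_cov_end d C) cov_endM linearD /= mxtrace_mulC; ring.
rewrite (eq_bigr (fun p => 2 * \tr (P *m (C i p k *: cov_end p P)))); last first.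
  by move=> p _; rewrite d1 -scalemxAr linearZ /=; ring.
rewrite -mulr_sumr -(linear_sum mxtrace) -mulmx_sumr d1 derM der_nat mul0r add0r.
rewrite -(trace_cov_end d C) cov_endM linearD /=.
rewrite -scalemxAr linearZ /= /cov2 [P *m (_ - \sum_p _)]mulmxBr linearB /=.
set s := \tr (P *m \sum_p _); set t := \tr _; set r := \tr _.
transitivity ((half * 2) * (h i k * (t + r - s))); first by ring.
by rewrite half2; ring.
Qed.

End LeviCivita.

Arguments selfadj {A m} g X.
Arguments dcol {A m} d u.
Arguments grad {A m} d h u.
Arguments hess {A m} d C u.
Arguments hessend {A m} d h C u.
Arguments lapl {A m} d h C u.
Arguments along {A m} d Y u.
Arguments trdiv {A m} d C P Y.
Arguments codazzi {A m} d C P.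
Arguments cov_end_along {A m} d C Y P.
Arguments cov2 {A m} d C i k P.
Arguments rough_lapl {A m} d h C P.
Arguments selfadj1 {A m} g.
Arguments along_trace_sq {A m d} C Y P.

(** * Curvature generated by a Schouten endomorphism *)

Section Schouten.
Context {A : comNzRingType} {m : nat} {d : derivations A m}.
Context {g h : 'M[A]_m} {C : 'I_m -> 'M[A]_m} (lc : levi_civita d g h C).
Implicit Types (i j k : 'I_m) (P X : 'M[A]_m).
Local Notation e j := (delta_mx j 0 : 'cV[A]_m).
Local Notation cov_vec := (cov_vec d C).
Local Notation cov_end := (cov_end d C).
Local Notation curv := (curv d C).
Local Notation selfadj := (selfadj g).
Local Notation grad := (grad d h).
Local Notation hessend := (hessend d h C).
Local Notation lapl := (lapl d h C).
Local Notation along := (along d).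
Local Notation trdiv := (trdiv d C).
Local Notation codazzi := (codazzi d C).
Local Notation rough_lapl := (rough_lapl d h C).
Local Notation cov_end_along := (cov_end_along d C).
Local Notation n := (m%:R : A).

(** Multiplied by g on the right, this is the skew-adjoint endomorphism attached
    to the coordinate vectors i and j. *)
Definition wedge i j : 'M[A]_m := delta_mx i j - delta_mx j i.

Lemma wedge_trace X (Z : 'cV[A]_m) i :
  \sum_j (X *m wedge i j *m Z) j 0 = (X^T *m Z) i 0 - \tr X * Z i 0.
Proof.
have dZ a b : (delta_mx a b *m Z) = Z b 0 *: (e a).
  apply/matrixP => p q; rewrite ord1 -(mul_delta_mx (0 : 'I_1)) -mulmxA -rowE.
  rewrite [row b Z]mx11_scalar mul_mx_scalar !mxE; congr (_ * _).
rewrite [in RHS]mxE /mxtrace mulr_suml -sumrB; apply: eq_bigr => j _.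
rewrite -mulmxA /wedge mulmxBl !dZ mulmxBr -!scalemxAr !mx_linE !mulmx_delta.
by rewrite mxE; ring.
Qed.

(** Vanishing of the Weyl tensor, with [P] as Schouten endomorphism. *)
Definition schouten_curv P := forall i j,
  curv i j = wedge i j *m (g *m P) + P *m wedge i j *m g.

(** The contraction of such a curvature tensor with a self-adjoint [X], see
    [schouten_curv_trace]; at [X = 1] it is minus the Ricci endomorphism. *)
Definition ricci_op P X : 'M[A]_m :=
  X *m P + P *m X - \tr X *: P - (\tr (X *m P))%:M.

Lemma schouten_curv_trace P X (Z : 'cV[A]_m) i :
  selfadj P -> selfadj X -> schouten_curv P ->
  \sum_j (X *m curv i j *m Z) j 0 = (g *m ricci_op P X *m Z) i 0.
Proof.
move=> sP sX cP.
have -> : \sum_j (X *m curv i j *m Z) j 0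
    = \sum_j (X *m wedge i j *m (g *m P *m Z)) j 0
      + \sum_j (X *m P *m wedge i j *m (g *m Z)) j 0.
  rewrite -big_split; apply: eq_bigr => j _ /=.
  rewrite cP -mxE_add; congr (fun_of_matrix _ j 0); mxring.
rewrite !wedge_trace.
have -> : X^T *m (g *m P *m Z) = g *m X *m P *m Z by rewrite !mulmxA sX.
have -> : (X *m P)^T *m (g *m Z) = g *m P *m X *m Z.
  by rewrite trmx_mul !mulmxA -[P^T *m X^T *m g]mulmxA sX mulmxA sP.
rewrite /ricci_op -scalemx1.
rewrite !(mulmxDr, mulmxDl, mulmxN, mulNmx) -!scalemxAr -!scalemxAl mulmx1.
by rewrite !mx_linE !mulmxA; ring.
Qed.

(** The curvature terms of [codazzi_rough_lapl] are contractions with [P] and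
    with [P *m P], both evaluated by [schouten_curv_trace]. *)
Lemma trace_mul_rough_lapl P : selfadj P -> codazzi P -> schouten_curv P ->
  \tr (P *m rough_lapl P)
    = \tr (P *m hessend (\tr P)) + n * \tr (P *m P *m P) - \tr P * \tr (P *m P).
Proof.
move=> sP cdP cP.
have trE (X : 'M[A]_m) : \tr X = \sum_j (X *m e j) j 0.
  by apply: eq_bigr => j _; rewrite mulmx_delta.
have step X : selfadj X -> forall Y : 'M[A]_m,
    \sum_j \sum_i (X *m curv i j *m (Y *m h *m e i)) j 0
    = \tr (ricci_op P X *m Y).
  move=> sX Y; rewrite exchange_big /=.
  under eq_bigr => i _ do
    rewrite (schouten_curv_trace _ _ sP sX cP) !mulmxA mulmx_delta.
  rewrite -/(mxtrace (g *m ricci_op P X *m Y *m h)) mxtrace_mulC !mulmxA.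
  by rewrite (lc_inv lc) mul1mx.
rewrite [LHS]trE.
under eq_bigr => j _.
  rewrite -mulmxA (codazzi_rough_lapl lc) // mulmxDr mulmx_sumr mxE summxE.
  under [X in _ + X]eq_bigr => i _.
    have -> : P *m ((curv i j *m P - P *m curv i j) *m h *m e i)
      = P *m curv i j *m (P *m h *m e i)
        - (P *m P) *m curv i j *m (1%:M *m h *m e i) by mxring.
    rewrite mxE_add mxE_opp; over.
  rewrite sumrB mulmxA mulmx_delta; over.
rewrite big_split sumrB /= -/(mxtrace (P *m hessend (\tr P))).
rewrite !step //; last exact: selfadj_sq.
rewrite mulmx1 /ricci_op !(mulmxDl, mulNmx) -!scalemxAl mul_scalar_mx.
rewrite !(raddfD, raddfN) /= !mxtraceZ mxtrace_scalar !mulmxA -mulr_natl; ring.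
Qed.

(** ** Gradient almost solitons *)

Context {P : 'M[A]_m} {v : 'cV[A]_m} {b : A}.
Hypothesis sP : selfadj P.
Hypothesis cdP : codazzi P.
Hypothesis cP : schouten_curv P.
Let H : 'M[A]_m := b%:M - (n - 2) *: P.
Hypothesis cov_vec_v : forall i, cov_vec i v = H *m e i.

Let a := \tr P.
Let a2 := \tr (P *m P).
Let a3 := \tr (P *m P *m P).
Let tau := \tr (P *m cov_end_along v P).

(** The skew part of the differential of [H] is on one hand the curvature applied
    to [v]; on the other hand [P] does not contribute to it, by the Codazzi
    equation, and only the derivatives of [b] remain. *)
Lemma soliton_curv i j : curv i j *m v = d i b *: e j - d j b *: e i.
Proof.
rewrite -(cov_vec_hessian_curv (lc_torsion lc) cov_vec_v) /H.
have dn k : d k (n - 2) = 0 by rewrite derB !der_nat subrr.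
rewrite -scalemx1 !cov_endD !cov_endN !cov_endZ !dn !cov_end1.
rewrite !scale0r !scaler0 !addr0 !add0r.
rewrite !(mulmxDl, mulNmx) -!scalemxAl !mul1mx (cdP j i).
mxring.
Qed.

(** [soliton_curv] contracted with [X]. *)
Lemma soliton_gradient X : selfadj X ->
  \tr X *: grad b - X *m grad b = ricci_op P X *m v.
Proof.
move=> sX; rewrite -[RHS](lowerK lc) /grad [X *m (h *m _)]mulmxA.
rewrite -(selfadj_raise lc sX) -mulmxA scalemxAr -mulmxBr; congr (h *m _).
apply/matrixP => i z; rewrite ord1 [g *m (_ *m v)]mulmxA.
rewrite -(schouten_curv_trace _ _ sP sX cP).
under eq_bigr => j _.
  rewrite -mulmxA soliton_curv mulmxBr -!scalemxAr !mx_linE !mulmx_delta; over.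
rewrite sumrB -mulr_sumr -/(mxtrace X) !mx_linE !mxE mulrC; congr (_ - _).
by apply: eq_bigr => j _; rewrite !mxE mulrC.
Qed.

Let trH : \tr H = n * b - (n - 2) * a.
Proof. by rewrite /H raddfB /= mxtraceZ mxtrace_scalar mulr_natl. Qed.

Let trPH : \tr (P *m H) = b * a - (n - 2) * a2.
Proof.
by rewrite /H mulmxBr raddfB /= -scalemxAr mxtraceZ mul_mx_scalar mxtraceZ.
Qed.

Let trPPH : \tr (P *m P *m H) = b * a2 - (n - 2) * a3.
Proof.
by rewrite /H mulmxBr raddfB /= -scalemxAr mxtraceZ mul_mx_scalar mxtraceZ.
Qed.

Let grad1 : (n - 1) *: grad b = - ((n - 2) *: (P *m v)) - a *: v.
Proof.
have := soliton_gradient (selfadj1 g).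
rewrite /ricci_op !mul1mx mulmx1 mxtrace1 -/a -[a%:M]scalemx1 => eqn.
have -> : (n - 1) *: grad b = n *: grad b - grad b.
  by rewrite scalerBl scale1r.
rewrite eqn; mxring.
Qed.

Let grad2 : a *: grad b - P *m grad b
  = 2 *: (P *m P *m v) - a *: (P *m v) - a2 *: v.
Proof.
rewrite (soliton_gradient sP) /ricci_op -/a -/a2 -[a2%:M]scalemx1; mxring.
Qed.

Let trdiv_v X : trdiv X v = \tr (X *m H).
Proof. exact: trdiv_endo. Qed.

Let trdiv_grad X : trdiv X (grad b) = \tr (X *m hessend b).
Proof. by apply: trdiv_endo => i; rewrite (cov_vec_grad lc). Qed.

Let trdiv_cst X c (Y : 'cV[A]_m) : (forall i, d i c = 0) ->
  trdiv X (c *: Y) = c * trdiv X Y.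
Proof. by move=> dc; rewrite trdivZ /along big1 ?add0r // => i _; rewrite dc mulr0. Qed.

Let dn1 i : d i (n - 1) = 0. Proof. by rewrite derB der_nat der1 subrr. Qed.
Let dn2 i : d i (n - 2) = 0. Proof. by rewrite derB !der_nat subrr. Qed.

Let div_P (Y : 'cV[A]_m) : trdiv 1%:M (P *m Y) = along Y a + trdiv P Y.
Proof.
by rewrite trdiv_mul codazzi_div // !mul1mx trace_cov_end_along.
Qed.

(** The divergence of [grad1]. *)
Lemma soliton_lapl :
  (n - 1) * lapl b = - ((n - 2) * (along v a + (b * a - (n - 2) * a2)))
                     - along v a - a * (n * b - (n - 2) * a).
Proof.
rewrite -?trH -?trPH -?trPPH.
have := congr1 (trdiv 1%:M) grad1.
rewrite (trdiv_cst _ _ dn1) trdiv_grad mul1mx trdivD !trdivN (trdiv_cst _ _ dn2).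
by rewrite div_P trdivZ !trdiv_v !mul1mx => ->; ring.
Qed.

(** The covariant differential of [grad1], traced against [P]. *)
Lemma soliton_trace_hess :
  (n - 1) * \tr (P *m hessend b)
    = - ((n - 2) * (tau + (b * a2 - (n - 2) * a3)))
      - along (P *m v) a - a * (b * a - (n - 2) * a2).
Proof.
rewrite -?trH -?trPH -?trPPH.
have := congr1 (trdiv P) grad1.
rewrite (trdiv_cst _ _ dn1) trdiv_grad trdivD !trdivN (trdiv_cst _ _ dn2) trdiv_mul.
rewrite codazzi_div // trdivZ !trdiv_v => ->; rewrite /tau; ring.
Qed.

(** The divergence of [grad2]. The derivatives of [P] along [v] occur in the
    terms with [P *m P] and with its trace, and they cancel. *)
Lemma soliton_div :
  a * lapl b - \tr (P *m hessend b)
    = along (P *m v) a + 2 * (b * a2 - (n - 2) * a3)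
      - a * along v a - a * (b * a - (n - 2) * a2) - a2 * (n * b - (n - 2) * a).
Proof.
rewrite -?trH -?trPH -?trPPH.
have := congr1 (trdiv 1%:M) grad2.
rewrite !(trdivD, trdivN) div_P !trdivZ !mul1mx.
rewrite trdiv_grad -[P *m P *m v]mulmxA !div_P trdiv_mul codazzi_div //.
rewrite -/tau !trdiv_v trdiv_grad !mul1mx (along_trace_sq C) -/tau -/(lapl b).
have -> : along (P *m (P *m v)) 2 = 0.
  by rewrite /along big1 // => i _; rewrite der_nat mulr0.
move=> eqn; transitivity
  ((along (grad b) a + a * lapl b) - (along (grad b) a + \tr (P *m hessend b))).
  by ring.
by rewrite eqn; ring.
Qed.

End Schouten.

Arguments schouten_curv {A m} d g C P.

(** * Christoffel symbols and conformal changes *)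

Section Christoffel.
Context {A : comNzRingType} {m : nat} (d : derivations A m) {half : A}.
Hypothesis half2 : half * 2 = 1.
Implicit Types (i j k l : 'I_m) (g h : 'M[A]_m).
Local Notation e j := (delta_mx j 0 : 'cV[A]_m).

Definition christoffel_mx g h i : 'M[A]_m := \matrix_(k, j)
  (half * \sum_l h k l * (d i (g j l) + d j (g i l) - d l (g i j))).

Lemma levi_civita_christoffel g h :
  g^T = g -> h *m g = 1%:M -> levi_civita d g h (christoffel_mx g h).
Proof.
move=> gT hg; have gC i j : g i j = g j i by rewrite -{1}gT mxE.
have gh : g *m h = 1%:M by exact: mulmx1C hg.
have low i j l : \sum_k g l k * christoffel_mx g h i k j
    = half * (d i (g j l) + d j (g i l) - d l (g i j)).
  transitivity (half *
      ((g *m h) *m \col_p (d i (g j p) + d j (g i p) - d p (g i j))) l 0).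
    rewrite -mulmxA mxE mulr_sumr; apply: eq_bigr => k _; rewrite !mxE.
    rewrite mulrCA; congr (_ * (_ * _)); apply: eq_bigr => p _.
    by rewrite mxE.
  by rewrite gh mul1mx mxE.
split=> // [i j|i].
  apply/matrixP => k z; rewrite ord1 !mulmx_delta !mxE (gC j i).
  by congr (_ * _); apply: eq_bigr => l _; rewrite [d j _ + _]addrC.
apply/matrixP => j l; rewrite !mxE.
under eq_bigr => k _ do rewrite mxE mulrC gC.
rewrite !low (gC l j).
by transitivity (half * 2 * d i (g j l)); [rewrite half2 mul1r | ring].
Qed.

(** The connection of a conformal metric exp(2u) g: the derivatives of
    [E = exp(2u)] contribute the three rank one terms in the differential and
    the gradient of u, and the factor [E] cancels against [E']. *)
Lemma christoffel_mx_conformal g h u E E' :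
  g^T = g -> h *m g = 1%:M -> E * E' = 1 -> (forall i, d i E = 2 * E * d i u) ->
  forall i, christoffel_mx (E *: g) (E' *: h) i
    = christoffel_mx g h i + (d i u)%:M + e i *m (dcol d u)^T
      - grad d h u *m ((e i)^T *m g).
Proof.
move=> gT hg EE dE i; have gC a b : g a b = g b a by rewrite -{1}gT mxE.
apply/matrixP => k j.
have hgE a : \sum_l h k l * g l a = (k == a)%:R.
  by have /matrixP/(_ k a) := hg; rewrite !mxE.
have outer (x : 'cV[A]_m) (y : 'rV[A]_m) a b : (x *m y) a b = x a 0 * y 0 b.
  by rewrite mxE big_ord1.
rewrite !(mx_linE, outer) /christoffel_mx trmx_delta -rowE !mxE.
transitivity (half * \sum_l (h k l * (d i (g j l) + d j (g i l) - d l (g i j))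
   + 2 * (d i u * (h k l * g l j) + d j u * (h k l * g l i)
          - g i j * (h k l * d l u)))).
  congr (_ * _); apply: eq_bigr => l _; rewrite !mxE !derM !dE (gC l j) (gC l i).
  transitivity (E * E' * (h k l * (d i (g j l) + d j (g i l) - d l (g i j))
    + 2 * (d i u * (h k l * g j l) + d j u * (h k l * g i l)
          - g i j * (h k l * d l u)))); first by ring.
  by rewrite EE mul1r.
rewrite big_split mulrDr -[RHS]addrA -[RHS]addrA /=; congr (_ + _).
rewrite -mulr_sumr mulrA half2 mul1r sumrB big_split /= -!mulr_sumr !hgE.
under [in RHS]eq_bigr => l _ do rewrite mxE.
by rewrite eqxx andbT -mulr_natr; ring.
Qed.

End Christoffel.

Section Conformal.
Context {A : comNzRingType} {m : nat} {d : derivations A m} {half : A}.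
Context {g h : 'M[A]_m} {C : 'I_m -> 'M[A]_m} (lc : levi_civita d g h C).
Hypothesis half2 : half * 2 = 1.
Context (u : A).
Implicit Types (i j k l : 'I_m).
Local Notation e j := (delta_mx j 0 : 'cV[A]_m).
Local Notation curv := (curv d).
Local Notation w := (grad d h u).
Local Notation U := (hessend d h C u).
Local Notation om := (dcol d u)^T.
Let q : A := (om *m w) 0 0.

Lemma curvD (B : 'I_m -> 'M[A]_m) i j :
  curv (fun k => C k + B k) i j
    = curv C i j + cov_end d C i (B j) - cov_end d C j (B i)
      + (B i *m B j - B j *m B i).
Proof. rewrite /curv /cov_end !dmxD; mxring. Qed.

(** Chosen such that exp(2u) g has zero curvature exactly when the curvature of
    g is the one generated by this endomorphism. *)
Definition conformal_schouten : 'M[A]_m := U - w *m om + (half * q)%:M.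
Local Notation P := conformal_schouten.

Let gw : g *m w = om^T.
Proof. by rewrite /grad (raiseK lc) trmxK. Qed.

Let omE : om = w^T *m g.
Proof. by rewrite -[RHS]trmxK trmx_mul trmxK (lc_sym lc) gw trmxK. Qed.

Let selfadjU : U^T *m g = g *m U.
Proof. exact: selfadj_hessend lc u. Qed.

Lemma cov_end_rank1 i (X Y : 'cV[A]_m) :
  cov_end d C i (X *m (Y^T *m g))
    = cov_vec d C i X *m (Y^T *m g) + X *m ((cov_vec d C i Y)^T *m g).
Proof.
rewrite /cov_end /cov_vec !dmxM (lc_compat lc) dmxT.
rewrite [(_ + C i *m Y)^T]raddfD /= trmx_mul; mxring.
Qed.

Let cov_end_wom i : cov_end d C i (w *m om) = U *m e i *m om + w *m (e i)^T *m g *m U.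
Proof.
rewrite omE cov_end_rank1 !(cov_vec_grad lc) [(U *m e i)^T]trmx_mul.
rewrite -[_ *m U^T *m g]mulmxA.
by rewrite selfadjU -omE !mulmxA.
Qed.

Lemma der_sqnorm i (Y : 'cV[A]_m) :
  d i ((Y^T *m g *m Y) 0 0) = 2 * (Y^T *m g *m cov_vec d C i Y) 0 0.
Proof.
pose X := Y^T *m g *m cov_vec d C i Y.
transitivity ((X + X^T) 0 0); last first.
  by rewrite mxE_add [_^T _ _]mxE; ring.
have -> : d i ((Y^T *m g *m Y) 0 0) = dmx d i (Y^T *m g *m Y) 0 0.
  by rewrite [RHS]mxE.
rewrite /X !trmx_mul trmxK (lc_sym lc) !dmxM (lc_compat lc) dmxT /cov_vec.
rewrite [(_ + C i *m Y)^T]raddfD /= trmx_mul; congr (fun_of_matrix _ 0 0).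
mxring.
Qed.

Let dq i : d i q = 2 * (om *m (U *m e i)) 0 0.
Proof. by rewrite /q omE der_sqnorm (cov_vec_grad lc). Qed.

Lemma conformal_schouten_selfadj : selfadj g P.
Proof.
have sw : (w *m om)^T *m g = g *m (w *m om).
  by rewrite [(w *m om)^T]trmx_mul -mulmxA -omE [RHS]mulmxA gw.
rewrite /selfadj /P raddfD raddfB /= tr_scalar_mx mulmxDl mulmxBl selfadjU sw.
by rewrite mul_scalar_mx mulmxDr mulmxBr mul_mx_scalar.
Qed.

(** The quadratic part of the curvature of a conformal metric; scalar summands
    commute and drop out. *)
Lemma rank1_commutator s1 s2 (x y z : 'cV[A]_m) (p p1 p2 : 'rV[A]_m) :
  let B1 := s1%:M + x *m p - z *m p1 in
  let B2 := s2%:M + y *m p - z *m p2 in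
  B1 *m B2 - B2 *m B1
    = (p *m y) 0 0 *: (x *m p) - (p *m x) 0 0 *: (y *m p)
      - (p *m z) 0 0 *: (x *m p2 - y *m p1)
      - ((p1 *m y) 0 0 - (p2 *m x) 0 0) *: (z *m p)
      + ((p1 *m z) 0 0 *: (z *m p2) - (p2 *m z) 0 0 *: (z *m p1)).
Proof.
move=> B1 B2; rewrite /B1 /B2 -[s1%:M]scalemx1 -[s2%:M]scalemx1.
rewrite !(mulmxDl, mulmxDr, mulmxN, mulNmx, mulmxA, mul1mx, mulmx1).
rewrite -!(scalemxAl, scalemxAr) !(mul1mx, mulmx1) !rank1_mul.
apply/matrixP => a b; rewrite !mx_linE; ring.
Qed.

Let B k := (d k u)%:M + e k *m om - w *m ((e k)^T *m g).

Let cov_end_B i j : cov_end d C i (B j)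
  = (d i (d j u))%:M + C i *m e j *m om + e j *m ((e i)^T *m (g *m U))
    - U *m e i *m ((e j)^T *m g) - w *m ((C i *m e j)^T *m g).
Proof.
rewrite /B -scalemx1 !(cov_endD, cov_endN) cov_endZ cov_end1 scaler0 addr0 scalemx1.
rewrite {1}omE !cov_end_rank1 -omE !(cov_vec_grad lc) !cov_vec_delta.
by rewrite [(U *m e i)^T]trmx_mul -[_ *m U^T *m g]mulmxA selfadjU opprD !addrA.
Qed.

Hypothesis flat : forall i j, curv (fun k => C k + B k) i j = 0.

(** The curvature of the perturbed connection is the old one, plus the skew part
    of the derivative of the perturbation (terms with the Hessian of u), plus a
    commutator (terms quadratic in the gradient of u). *)
Lemma conformal_schouten_curv : schouten_curv d g C P.
Proof.
move=> i j; have := flat i j; rewrite curvD !cov_end_B; move: (curv C i j) => K.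
rewrite rank1_commutator.
have gCg k l : ((e k)^T *m g *m e l) 0 0 = g k l.
  by rewrite trmx_delta -rowE mulmx_delta mxE.
have ome k : (om *m e k) 0 0 = d k u by rewrite mulmx_delta !mxE.
have gamw k : ((e k)^T *m g *m w) 0 0 = d k u.
  by rewrite -mulmxA gw trmxK trmx_delta -rowE !mxE.
have qE : q = 2 * (half * q) by rewrite mulrA [2 * half]mulrC half2 mul1r.
rewrite !gCg !ome !gamw -/q qE.
have gC : g i j = g j i by rewrite -[in LHS](lc_sym lc) mxE.
rewrite gC subrr scale0r subr0 (derC d i j) (lc_torsion lc j i).
have -> : wedge i j = e i *m (e j)^T - e j *m (e i)^T.
  by rewrite !trmx_delta !mul_delta_mx.
rewrite -!addrA => /eqP; rewrite addr_eq0 => /eqP ->.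
rewrite /P -[(half * q)%:M]scalemx1.
have := ome i; have := ome j; have := gamw i; have := gamw j.
move: (half * q) U w om (d i u) (d j u) => r U' w' om' ui uj gj gi oj oi.
have rank1_mul_g (x : 'cV[A]_m) (y : 'rV[A]_m) (z : 'cV[A]_m) (t : 'rV[A]_m) :
    x *m y *m g *m z *m t = (y *m g *m z) 0 0 *: (x *m t).
  by rewrite -[x *m y *m g]mulmxA rank1_mul.
rewrite !(mulmxDl, mulmxDr, mulmxN, mulNmx, mulmxA) -!(scalemxAl, scalemxAr).
rewrite !(mulmx1, mul1mx, mulmxA) !(rank1_mul_g, rank1_mul) oi oj gi gj.
rewrite -!scalemxAl; apply/matrixP => a b; rewrite !mx_linE; ring.
Qed.

(** The skew part of the differential of the Hessian of u is the curvature
    applied to the gradient of u. Inserting [conformal_schouten_curv] there, it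
    cancels the skew part coming from the quadratic terms. *)
Lemma conformal_schouten_codazzi : codazzi d C P.
Proof.
move=> i j; have := cov_vec_hessian_curv (lc_torsion lc) (cov_vec_grad lc u) i j.
rewrite conformal_schouten_curv.
have -> : wedge i j = e i *m (e j)^T - e j *m (e i)^T.
  by rewrite !trmx_delta !mul_delta_mx.
have half_dq k : half * d k q = (om *m U *m e k) 0 0.
  by rewrite dq mulrA half2 mul1r mulmxA.
have dhalf k : d k half = 0 by exact: der_inv_nat half2.
have cov_end_P k l : cov_end d C k P *m e l = cov_end d C k U *m e l
    - (U *m e k *m om *m e l + w *m (e k)^T *m g *m U *m e l)
    + (om *m U *m e k) 0 0 *: e l.
  rewrite /P -[(half * q)%:M]scalemx1 !(cov_endD, cov_endN).
  rewrite cov_endZ cov_end1 scaler0 addr0 derM dhalf mul0r add0r half_dq cov_end_wom.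
  move: (cov_end d C k U) (U *m e k *m om) (w *m (e k)^T *m g *m U) => X Y Z.
  by move: ((om *m U *m e k) 0 0) => s; mxring.
rewrite !cov_end_P /P -[(half * q)%:M]scalemx1.
move: (cov_end d C i U *m e j) (cov_end d C j U *m e i) => X Y.
have selfU x (y : 'cV[A]_m) : ((e x)^T *m g *m U *m y) 0 0 = (y^T *m g *m U *m e x) 0 0.
  transitivity ((y^T *m g *m U *m e x)^T 0 0); last by rewrite mxE.
  congr (fun_of_matrix _ 0 0).
  move: U selfadjU => U' sU'; rewrite !trmx_mul trmxK (lc_sym lc) !mulmxA.
  by rewrite -[_ *m U'^T *m g]mulmxA sU' !mulmxA.
have qE : (om *m w) 0 0 = 2 * (half * q).
  by rewrite mulrA [2 * half]mulrC half2 mul1r.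
have sU : ((e i)^T *m g *m U *m e j) 0 0 = ((e j)^T *m g *m U *m e i) 0 0.
  exact: selfU.
have := selfU i w; have := selfU j w; rewrite -omE.
have ome k : (om *m e k) 0 0 = d k u by rewrite mulmx_delta !mxE.
have gamw k : ((e k)^T *m g *m w) 0 0 = d k u.
  by rewrite -mulmxA gw trmxK trmx_delta -rowE !mxE.
have := ome i; have := ome j; have := gamw i; have := gamw j.
move: qE sU; move: (half * q) U w om (d i u) (d j u).
move=> r U' w' om' ui uj qE sU gj gi oj oi tj ti.
have rank1_vec (x y : 'cV[A]_m) (p : 'rV[A]_m) :
    x *m p *m y = (p *m y) 0 0 *: x.
  by rewrite -mulmxA [p *m y]mx11_scalar mul_mx_scalar !mxE eqxx mulr1n.
have rank1_vec_g (x y : 'cV[A]_m) (p : 'rV[A]_m) :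
    x *m p *m g *m y = (p *m g *m y) 0 0 *: x.
  by rewrite -[x *m p *m g]mulmxA rank1_vec.
have rank1_vec_gU (x y : 'cV[A]_m) (p : 'rV[A]_m) :
    x *m p *m g *m U' *m y = (p *m g *m U' *m y) 0 0 *: x.
  by rewrite -[x *m p *m g]mulmxA -[x *m _ *m U']mulmxA rank1_vec.
move/eqP; rewrite subr_eq => /eqP ->.
rewrite !(mulmxDl, mulmxDr, mulmxN, mulNmx, mulmxA) -!(scalemxAl, scalemxAr).
rewrite !(mulmx1, mul1mx, mulmxA).
rewrite !(rank1_vec_gU, rank1_vec_g, rank1_vec).
rewrite tj ti sU qE gj gi oj oi.
apply/matrixP => a b; rewrite !mx_linE; ring.
Qed.

End Conformal.

(** * The Bochner formula and the Ricci tensor *)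

Section Bochner.
Context {A : comNzRingType} {m : nat} {d : derivations A m}.
Context {g h : 'M[A]_m} {C : 'I_m -> 'M[A]_m} (lc : levi_civita d g h C).
Implicit Types (i j k : 'I_m) (P X : 'M[A]_m).
Local Notation e j := (delta_mx j 0 : 'cV[A]_m).
Local Notation cov_end := (cov_end d C).
Local Notation curv := (curv d C).
Local Notation n := (m%:R : A).

Lemma hessB x y : hess d C (x - y) = hess d C x - hess d C y.
Proof.
apply/matrixP => i j; rewrite !mxE !derB.
under eq_bigr => k _ do rewrite derB mulrBr.
by rewrite sumrB; ring.
Qed.

Lemma hessendB x y : hessend d h C (x - y) = hessend d h C x - hessend d h C y.
Proof. by rewrite /hessend hessB mulmxBr. Qed.

Lemma laplB x y : lapl d h C (x - y) = lapl d h C x - lapl d h C y.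
Proof. by rewrite /lapl hessendB raddfB. Qed.

Lemma trace_rough_lapl P : \tr (rough_lapl d h C P) = lapl d h C (\tr P).
Proof.
rewrite (laplE lc) /rough_lapl linear_sum; apply: eq_bigr => i _ /=.
rewrite linear_sum; apply: eq_bigr => k _ /=.
rewrite linearZ /=; congr (_ * _); rewrite /cov2 raddfB /= !trace_cov_end linear_sum.
by congr (_ - _); apply: eq_bigr => p _; rewrite linearZ /= trace_cov_end.
Qed.

(** ** Affine combinations with the identity *)

Section AffineCombination.
Context (P : 'M[A]_m) (c s : A).
Hypothesis dc : forall i, d i c = 0.
Let N : 'M[A]_m := c *: P - s%:M.

Let cov_endN' i : cov_end i N = c *: cov_end i P - (d i s)%:M.
Proof.
rewrite /N -[s%:M]scalemx1 cov_endD cov_endN !cov_endZ dc.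
rewrite scale0r add0r cov_end1 scaler0.
by rewrite addr0 scalemx1.
Qed.

Let cov_end2 i k :
  cov_end i (cov_end k N) = c *: cov_end i (cov_end k P) - (d i (d k s))%:M.
Proof.
rewrite cov_endN' -[(d k s)%:M]scalemx1 cov_endD cov_endN !cov_endZ dc scale0r.
rewrite add0r cov_end1.
by rewrite scaler0 addr0 scalemx1.
Qed.

Lemma rough_lapl_affine :
  rough_lapl d h C N = c *: rough_lapl d h C P - (lapl d h C s)%:M.
Proof.
rewrite (laplE lc) /rough_lapl scaler_sumr -[(\sum_i _)%:M]scalemx1 scaler_suml.
rewrite -sumrB; apply: eq_bigr => i _.
rewrite scaler_sumr scaler_suml -sumrB; apply: eq_bigr => k _.
rewrite /cov2 cov_end2; under eq_bigr => p _ do rewrite cov_endN'.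
under eq_bigr => p _ do rewrite scalerBr -[(d p s)%:M]scalemx1 2!scalerA.
rewrite sumrB -scaler_suml -[(d i (d k s))%:M]scalemx1.
under eq_bigr => p _ do rewrite mulrC -scalerA.
rewrite -scaler_sumr; apply/matrixP => a b; rewrite !mx_linE; ring.
Qed.

Lemma cov_end_along_affine v :
  cov_end_along d C v N = c *: cov_end_along d C v P - (along d v s)%:M.
Proof.
rewrite /cov_end_along /along scaler_sumr -[(\sum_i _)%:M]scalemx1 scaler_suml.
rewrite -sumrB; apply: eq_bigr => i _.
rewrite cov_endN' -[(d i s)%:M]scalemx1.
apply/matrixP => a b; rewrite !mx_linE; ring.
Qed.

(** Bochner's formula for a trace-free [N = c P - s] with constant [c]: the
    multiples of the identity in the derivatives of [N] are killed by the trace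
    against [N]. *)
Lemma bochner_affine v (half : A) : half * 2 = 1 -> \tr N = 0 ->
  half * (lapl d h C (\tr (N *m N)) - along d v (\tr (N *m N)))
    = \sum_i \sum_k h i k * \tr (cov_end i N *m cov_end k N)
      + c * (c * \tr (P *m rough_lapl d h C P) - s * lapl d h C (\tr P)
             - (c * \tr (P *m cov_end_along d C v P) - s * along d v (\tr P))).
Proof.
move=> half2 trN; rewrite mulrBr (half_lapl_trace_sq lc _ half2).
rewrite (along_trace_sq C) mulrA half2 mul1r.
rewrite rough_lapl_affine cov_end_along_affine !mulmxBr !raddfB /=.
rewrite !mul_mx_scalar !mxtraceZ -!scalemxAr !mxtraceZ trN !mulr0 !subr0.
rewrite /N !mulmxBl -!scalemxAl !mul_scalar_mx !raddfB /= !mxtraceZ.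
rewrite trace_rough_lapl trace_cov_end_along; ring.
Qed.

Lemma trace_affine : \tr N = c * \tr P - n * s.
Proof. by rewrite /N raddfB /= mxtraceZ mxtrace_scalar mulr_natl. Qed.

Let trace_mul_affine X : \tr (X *m N) = c * \tr (X *m P) - s * \tr X.
Proof.
by rewrite /N mulmxBr raddfB /= -scalemxAr mul_mx_scalar !mxtraceZ.
Qed.

Lemma trace_sq_affine :
  \tr (N *m N) = c ^+ 2 * \tr (P *m P) - 2 * c * s * \tr P + n * s ^+ 2.
Proof.
rewrite trace_mul_affine mxtrace_mulC trace_mul_affine trace_affine; ring.
Qed.

Lemma trace_cube_affine :
  \tr (N *m N *m N) = c ^+ 3 * \tr (P *m P *m P) - 3 * c ^+ 2 * s * \tr (P *m P)
    + 3 * c * s ^+ 2 * \tr P - n * s ^+ 3.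
Proof.
rewrite trace_mul_affine trace_sq_affine mxtrace_mulC mulmxA trace_mul_affine.
rewrite [\tr (P *m N)]trace_mul_affine mxtrace_mulC mulmxA trace_mul_affine; ring.
Qed.

End AffineCombination.

(** ** Covariant 2-tensors *)

Definition cov_deriv_mx k (X : 'M[A]_m) : 'M[A]_m :=
  dmx d k X - ((C k)^T *m X + X *m C k).

Lemma cov_deriv_mx_sym k X : X^T = X -> (cov_deriv_mx k X)^T = cov_deriv_mx k X.
Proof.
move=> sX; rewrite /cov_deriv_mx linearB linearD /= !trmx_mul trmxK -dmxT sX.
by rewrite [in LHS]addrC [X in _ - X]addrC; rewrite addrC.
Qed.

(** The connection commutes with raising an index. *)
Lemma raise_cov_deriv k X : h *m cov_deriv_mx k X = cov_end k (h *m X).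
Proof.
rewrite /cov_deriv_mx /cov_end dmxM (dmx_inv lc); mxring.
Qed.

(** ** The Ricci tensor *)

Definition ricci_mx : 'M[A]_m := \matrix_(j, k) \sum_i curv i j i k.

Lemma ricci_mx_schouten P : selfadj g P -> schouten_curv d g C P ->
  h *m ricci_mx = (n - 2) *: P + (\tr P)%:M.
Proof.
move=> sP cP; rewrite -[RHS](lowerK lc); congr (h *m _).
apply/matrixP => j k; rewrite mxE.
have curvN i : curv i j = - (1%:M *m curv j i).
  by rewrite mul1mx /curv; mxring.
under eq_bigr => i _ do rewrite curvN mxE_opp -mulmx_delta.
rewrite sumrN (schouten_curv_trace _ _ sP (selfadj1 g) cP) -mxE_opp.
rewrite -[RHS]mulmx_delta; congr (fun_of_matrix _ j 0).
rewrite /ricci_op !mul1mx mulmx1 mxtrace1 -[(\tr P)%:M]scalemx1; mxring.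
Qed.

End Bochner.

Arguments ricci_mx {A m} d C.
Arguments cov_deriv_mx {A m} d C k X.

(** * The formula for trace-free Ricci on a soliton *)

(** The scalars stand for: [a, a2, a3] the traces of the powers of [P]; [va, vAa]
    the derivatives of [a] along [v] and [P v]; [tau] the trace of [P] times its
    derivative along [v]; [box] that of [P] times its rough Laplacian; [hb, hl]
    the traces of [P] against the Hessians of [b] and lambda; [Lb, Ll] their
    Laplacians. The hypotheses are linear in [Lb], [hb], [tau] and are solved
    for these. *)
Lemma soliton_scalar_identity (F : fieldType)
    (n a b a2 a3 va vAa tau box hb hl Lb Ll grad2 : F) :
  n != 0 -> n - 1 != 0 -> n - 2 != 0 ->
  box = (hl - hb) + n * a3 - a * a2 ->
  (n - 1) * Lb = - ((n - 2) * (va + (b * a - (n - 2) * a2))) - va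
                 - a * (n * b - (n - 2) * a) ->
  (n - 1) * hb = - ((n - 2) * (tau + (b * a2 - (n - 2) * a3))) - vAa
                 - a * (b * a - (n - 2) * a2) ->
  a * Lb - hb = vAa + 2 * (b * a2 - (n - 2) * a3)
      - a * va - a * (b * a - (n - 2) * a2) - a2 * (n * b - (n - 2) * a) ->
  let c := n - 2 in
  let s := c * a / n in
  grad2 + c * (c * box - s * (Ll - Lb) - (c * tau - s * va))
  = grad2 + 2 * (a + b - 2 * (n - 1) * a * ((n - 2) / (n * (n - 1))))
        * (c ^+ 2 * a2 - 2 * c * s * a + n * s ^+ 2)
      + (n - 2) * (c * hl - s * Ll)
      + 4 / (n - 2) * (c ^+ 3 * a3 - 3 * c ^+ 2 * s * a2 + 3 * c * s ^+ 2 * a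
                       - n * s ^+ 3).
Proof.
move=> n0 n1 n2 -> eLb ehb ediv c s.
have Lb_def : Lb = (- ((n - 2) * (va + (b * a - (n - 2) * a2))) - va
                 - a * (n * b - (n - 2) * a)) / (n - 1).
  by rewrite -eLb mulrC mulKf.
have hb_def : hb = a * Lb - (vAa + 2 * (b * a2 - (n - 2) * a3)
      - a * va - a * (b * a - (n - 2) * a2) - a2 * (n * b - (n - 2) * a)).
  by rewrite -ediv; ring.
have tau_def : tau = (- ((n - 1) * hb) - vAa - a * (b * a - (n - 2) * a2)
       - (n - 2) * (b * a2 - (n - 2) * a3)) / (n - 2).
  by rewrite ehb; field.
rewrite tau_def hb_def Lb_def /s /c; field.
by rewrite n0 n1 n2.
Qed.

Section SolitonFormula.
Context {A : comNzRingType} {m : nat} {d : derivations A m} {half ninv : A}.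
Context {g h : 'M[A]_m} {C : 'I_m -> 'M[A]_m} (lc : levi_civita d g h C).
Local Notation n := (m%:R : A).
Hypothesis half2 : half * 2 = 1.
Hypothesis ninv_n : ninv * n = 1.
Context {P : 'M[A]_m}.
Hypothesis sP : selfadj g P.
Hypothesis cdP : codazzi d C P.
Hypothesis cP : schouten_curv d g C P.
Context {f lam : A}.
Hypothesis soliton : ricci_mx d C + hess d C f = lam *: g.

Let v := grad d h f.
Let a := \tr P.
Let S := \tr (h *m ricci_mx d C).
Definition tracefree_ricci_mx : 'M[A]_m := ricci_mx d C - (ninv * S) *: g.
Local Notation T := tracefree_ricci_mx.
Let N := h *m T.
Let c := n - 2.
Let s := c * (ninv * a).

Let scalE : S = 2 * (n - 1) * a.
Proof.
rewrite /S (ricci_mx_schouten lc sP cP) raddfD /= mxtraceZ mxtrace_scalar.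
by rewrite -mulr_natl -/a; ring.
Qed.

Lemma raise_tracefree_ricci : N = c *: P - s%:M.
Proof.
rewrite /N /T mulmxBr -scalemxAr (lc_inv lc) (ricci_mx_schouten lc sP cP) scalE.
rewrite -/a -/c scalemx1 -addrA -raddfB; congr (_ + _).
rewrite -raddfN; congr (_%:M).
transitivity (ninv * n * a - ninv * (2 * (n - 1) * a)); first by rewrite ninv_n mul1r.
by rewrite /s /c; ring.
Qed.

Lemma tracefree_ricci_sym : T^T = T.
Proof.
have -> : T = g *m N by rewrite /N (raiseK lc).
have sN : selfadj g N.
  rewrite raise_tracefree_ricci -scalemx1.
  apply: selfadjD; first exact: selfadjZ.
  by apply: selfadjN; apply: selfadjZ; apply: selfadj1.
by rewrite trmx_mul (lc_sym lc) sN.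
Qed.

Lemma trace_tracefree_ricci : \tr N = 0.
Proof.
rewrite raise_tracefree_ricci trace_affine -/a /s.
transitivity (c * a - ninv * n * (c * a)); first by ring.
by rewrite ninv_n mul1r subrr.
Qed.

Let b := lam - a.

Let cov_vec_v i : cov_vec d C i v = (b%:M - c *: P) *m delta_mx i 0.
Proof.
rewrite (cov_vec_grad lc); congr (_ *m _).
have := congr1 (mulmx h) soliton.
rewrite mulmxDr -scalemxAr (lc_inv lc) (ricci_mx_schouten lc sP cP) scalemx1.
rewrite -/a -/c => e; rewrite /b raddfB /= -e /hessend; mxring.
Qed.

(** The morphism [phi] serves to divide by the integers [n - 1] and [n - 2],
    which need not be invertible in [A]. *)
Lemma soliton_formula (F : fieldType) (phi : {rmorphism A -> F}) :
  m%:R - 1 != 0 :> F -> m%:R - 2 != 0 :> F ->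
  phi (half * (lapl d h C (\tr (N *m N)) - along d v (\tr (N *m N))))
    = phi (\sum_i \sum_k h i k * \tr (cov_end d C i N *m cov_end d C k N))
      + 2 * (phi lam - phi S * ((m%:R - 2) / (m%:R * (m%:R - 1)))) * phi (\tr (N *m N))
      + (m%:R - 2) * phi (\tr (hessend d h C lam *m N))
      + 4 / (m%:R - 2) * phi (\tr (N *m N *m N)).
Proof.
move=> n1 n2.
have ninvF : phi ninv * m%:R = 1 by rewrite -(rmorph_nat phi) -rmorphM ninv_n rmorph1.
have n0 : m%:R != 0 :> F.
  by apply/eqP => n0; move/eqP: ninvF; rewrite n0 mulr0 eq_sym oner_eq0.
have trN := trace_tracefree_ricci; have NE := raise_tracefree_ricci.
have dc i : d i c = 0 by rewrite derB !der_nat subrr.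
have bochner := bochner_affine (P := P) (s := s) lc dc v half2; rewrite -NE in bochner.
rewrite (bochner trN) {bochner}.
have -> : \tr (hessend d h C lam *m N)
    = c * \tr (P *m hessend d h C lam) - s * lapl d h C lam.
  rewrite NE mulmxBr raddfB /= -scalemxAr mul_mx_scalar !mxtraceZ.
  by rewrite [\tr (_ *m P)]mxtrace_mulC.
rewrite NE trace_sq_affine trace_cube_affine -NE.
rewrite (trace_mul_rough_lapl lc sP cdP cP) -/a.
have hess_a : \tr (P *m hessend d h C a)
    = \tr (P *m hessend d h C lam) - \tr (P *m hessend d h C b).
  have -> : a = lam - b by rewrite /b; ring.
  by rewrite hessendB mulmxBr raddfB.
have lapl_a : lapl d h C a = lapl d h C lam - lapl d h C b.
  by rewrite -laplB; congr lapl; rewrite /b; ring.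
rewrite hess_a lapl_a.
have e1 := congr1 phi (soliton_lapl lc sP cdP cP cov_vec_v).
have e2 := congr1 phi (soliton_trace_hess lc sP cdP cP cov_vec_v).
have e3 := congr1 phi (soliton_div lc sP cdP cP cov_vec_v).
rewrite -/a -/c -/v in e1 e2 e3.
move: e1 e2 e3; rewrite scalE.
move: (\sum_i _) (\tr (P *m P)) (\tr (P *m P *m P)) => D a2 a3.
move: (lapl d h C b) (lapl d h C lam) (\tr (P *m hessend d h C b)) => Lb Ll hb.
move: (\tr (P *m hessend d h C lam)) (\tr (P *m cov_end_along d C v P)) => hl tau.
move: (along d v a) (along d (P *m v) a) => va vAa.
have -> : lam = a + b by rewrite /b; ring.
rewrite /s /c; move: a b => a' b'.
move=> e1 e2 e3.
have ninvE : phi ninv = m%:R^-1 by apply: (mulIf n0); rewrite ninvF mulVf.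
have := @soliton_scalar_identity F m%:R (phi a') (phi b') (phi a2) (phi a3) (phi va)
  (phi vAa) (phi tau) _ (phi hb) (phi hl) (phi Lb) (phi Ll) (phi D) n0 n1 n2 erefl.
move=> arith.
apply: etrans (etrans _ (arith _ _ _)) _.
- by rewrite -ninvE; ring.
- by transitivity (phi ((n - 1) * Lb)); [ring | rewrite e1; ring].
- by transitivity (phi ((n - 1) * hb)); [ring | rewrite e2; ring].
- by transitivity (phi (a' * Lb - hb)); [ring | rewrite e3; ring].
- by rewrite -ninvE; ring.
Qed.

End SolitonFormula.
Arguments tracefree_ricci_mx {A m} d ninv g h C.

(** * Okumura's inequality *)

Section Okumura.
Context {R : rcfType}.

Definition posdef m (G : 'M[R]_m) :=
  forall v : 'rV[R]_m, v != 0 -> 0 < (v *m G *m v^T) 0 0.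

(** Induction on the dimension, splitting off the first coordinate: the Schur
    complement of a positive definite matrix is again positive definite, since
    its form is the restriction of the given form to the orthogonal of the first
    basis vector. *)
Lemma posdef_orthonormal_basis m (G : 'M[R]_m) :
  G^T = G -> posdef G -> exists Q : 'M[R]_m, Q *m G *m Q^T = 1%:M.
Proof.
elim: m G => [|m IH] G GT G0.
  by exists 0; apply/matrixP => -[].
move: G GT G0; rewrite -[m.+1]/(1 + m)%N => G GT G0.
have [eul eur edl edr] : [/\ (ulsubmx G)^T = ulsubmx G, (dlsubmx G)^T = ursubmx G,
    (ursubmx G)^T = dlsubmx G & (drsubmx G)^T = drsubmx G].
  by rewrite trmx_ulsub trmx_dlsub trmx_ursub trmx_drsub GT.
pose a := ulsubmx G 0 0; pose b := ursubmx G; pose D := drsubmx G.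
have aE : ulsubmx G = a%:M by rewrite [LHS]mx11_scalar.
have GE : G = block_mx a%:M b b^T D by rewrite -aE edl submxK.
have G_quad (x : 'rV[R]_1) (y : 'rV[R]_m) : row_mx x y *m G *m (row_mx x y)^T
    = a *: (x *m x^T) + y *m b^T *m x^T + x *m b *m y^T + y *m D *m y^T.
  rewrite GE mul_row_block tr_row_mx mul_row_col !mulmxDl.
  by rewrite mul_mx_scalar -scalemxAl addrA.
have a0 : 0 < a.
  have := G0 (row_mx 1%:M 0); rewrite G_quad trmx0 !mul0mx !mulmx0 !addr0.
  rewrite trmx1 mulmx1 !mxE mulr1; apply.
  apply/eqP => /(congr1 lsubmx); rewrite row_mxKl => /matrixP/(_ 0 0).
  by rewrite !mxE => /eqP; rewrite oner_eq0.
have [||Q HQ] := IH (D - a^-1 *: (b^T *m b)).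
- by rewrite linearB linearZ /= trmx_mul trmxK edr.
- move=> y y0; have [be yb] : exists be, y *m b^T = be%:M.
    by exists ((y *m b^T) 0 0); rewrite -mx11_scalar.
  have by_ : b *m y^T = be%:M by rewrite -[b]trmxK -trmx_mul yb tr_scalar_mx.
  have -> : y *m (D - a^-1 *: (b^T *m b)) *m y^T
      = row_mx (- (be / a))%:M y *m G *m (row_mx (- (be / a))%:M y)^T.
    rewrite G_quad tr_scalar_mx mulmxBr mulmxBl -scalemxAr -scalemxAl.
    rewrite !mulmxA yb -!mulmxA by_ -!scalar_mxM !scale_scalar_mx.
    have sc (x : R) : (x%:M : 'M[R]_1) 0 0 = x by rewrite mxE eqxx mulr1n.
    apply/matrixP => i j; rewrite !ord1 !mx_linE !sc; field.
    by rewrite gt_eqF.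
  apply: G0; apply: contraNneq y0 => /(congr1 rsubmx).
  by rewrite row_mxKr linear0 => ->.
exists (block_mx (Num.sqrt a)^-1%:M 0 (- a^-1 *: (Q *m b^T)) Q).
rewrite GE tr_block_mx !tr_scalar_mx trmx0 !mulmx_block.
rewrite !mul0mx !mulmx0 !addr0.
have an0 : a != 0 by rewrite gt_eqF.
have sq0 : Num.sqrt a != 0 by rewrite sqrtr_eq0 -ltNge.
have low0 : - a^-1 *: (Q *m b^T) *m a%:M + Q *m b^T = 0.
  by rewrite mul_mx_scalar scalerA mulrN divff // scaleN1r addNr.
rewrite low0 !mul0mx add0r -!scalar_mxM !linearZ /= trmx_mul trmxK.
rewrite -!mulmxA !mul_scalar_mx !scalerA -scalerDl.
have -> : - a^-1 *: (Q *m b^T) *m b + Q *m D = Q *m (D - a^-1 *: (b^T *m b)).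
  rewrite mulmxBr -scalemxAl -scalemxAr scaleNr mulmxA addrC; done.
rewrite -mulmxA mulmxA HQ [RHS]scalar_mx_block; congr block_mx.
  congr (_%:M); rewrite -{2}(sqr_sqrtr (ltW a0)); field; done.
rewrite -[RHS](scale0r (b *m Q^T)); congr (_ *: _); field.
by rewrite sq0 an0.
Qed.

Lemma trace_mul_sym_ge0 m (N : 'M[R]_m) : N^T = N -> 0 <= \tr (N *m N).
Proof.
move=> sN; apply: sumr_ge0 => i _; rewrite mxE; apply: sumr_ge0 => j _.
by rewrite -{2}sN mxE -expr2 sqr_ge0.
Qed.

Lemma outer_self_trace m (w : 'rV[R]_m) (N : 'M[R]_m) :
  \tr (N *m (w^T *m w)) = (w *m N *m w^T) 0 0.
Proof.
rewrite mulmxA mxtrace_mulC mulmxA.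
by rewrite [X in \tr X]mx11_scalar mxtrace_scalar.
Qed.

Lemma discriminant_le0 (s x K : R) :
  0 <= K -> (forall t, 0 <= s + 2 * t * x + t ^+ 2 * K) -> x ^+ 2 <= s * K.
Proof.
rewrite le_eqVlt => /predU1P[<- quad|K0 quad].
  have [->|x0] := eqVneq x 0; first by rewrite expr0n mulr0.
  (* at this t the affine function s + 2 t x takes the value - 1 *)
  have := quad (- ((s + 1) / (2 * x))).
  have -> : s + 2 * - ((s + 1) / (2 * x)) * x + (- ((s + 1) / (2 * x))) ^+ 2 * 0 = -1.
    by field; rewrite x0.
  by rewrite oppr_ge0 ler10.
(* the minimum of the quadratic function *)
have := quad (- (x / K)).
have -> : s + 2 * - (x / K) * x + (- (x / K)) ^+ 2 * K = (s * K - x ^+ 2) / K.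
  by field; rewrite gt_eqF.
by rewrite pmulr_lge0 ?invr_gt0 // subr_ge0.
Qed.

(** Cauchy-Schwarz for the trace form, applied to [N] and the trace-free part of
    the projection on [w]. *)
Lemma tracefree_form_bound m (N : 'M[R]_m) (w : 'rV[R]_m) :
  (0 < m)%N -> N^T = N -> \tr N = 0 ->
  (w *m N *m w^T) 0 0 ^+ 2
    <= \tr (N *m N) * ((w *m w^T) 0 0 ^+ 2 * ((m%:R - 1) / m%:R)).
Proof.
move=> m0 sN trN; set x := (w *m N *m w^T) 0 0; set r := (w *m w^T) 0 0.
have n0 : m%:R != 0 :> R by rewrite pnatr_eq0 -lt0n.
set K := r ^+ 2 * _; set s2 := \tr _.
have quad t : 0 <= s2 + 2 * t * x + t ^+ 2 * K.
  have := @trace_mul_sym_ge0 m (N + t *: (w^T *m w - (r / m%:R)%:M)).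
  rewrite linearD linearZ /= linearB /= trmx_mul trmxK tr_scalar_mx sN.
  move=> /(_ erefl); congr (0 <= _).
  have rE : \tr (w^T *m w) = r.
    by rewrite -[w^T *m w]mul1mx outer_self_trace mulmx1.
  have ww : w^T *m w *m (w^T *m w) = r *: (w^T *m w).
    rewrite -mulmxA [w *m _]mulmxA [w *m w^T]mx11_scalar mul_scalar_mx.
    by rewrite scalemxAr.
  rewrite -[(r / _)%:M]scalemx1.
  rewrite !(mulmxDl, mulmxDr, mulmxN, mulNmx) -!(scalemxAl, scalemxAr).
  rewrite !(mulmxDl, mulmxDr, mulmxN, mulNmx) -?(scalemxAl, scalemxAr).
  rewrite !(mulmx1, mul1mx) ww !(raddfD, raddfN) /= !mxtraceZ.
  rewrite [\tr (w^T *m w *m N)]mxtrace_mulC !outer_self_trace trN rE mxtrace1.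
  by rewrite -/x -/s2 /K; field.
apply: discriminant_le0 => //; rewrite /K mulr_ge0 ?sqr_ge0 // divr_ge0 //.
by rewrite subr_ge0 ler1n.
Qed.

(** The trace of [(N - al)^2 (N + be)] is nonnegative, as [N + be] is positive
    semidefinite by [tracefree_form_bound]. In the equality case of the lemma
    the eigenvalues of [N] are [al], with multiplicity [m - 1], and [- be]. *)
Lemma okumura_sym m (N : 'M[R]_m) : (1 < m)%N -> N^T = N -> \tr N = 0 ->
  - ((m%:R - 2) / Num.sqrt (m%:R * (m%:R - 1)) * Num.sqrt (\tr (N *m N)) ^+ 3)
    <= \tr (N *m N *m N).
Proof.
move=> m1 sN trN; have m0 : (0 < m)%N by apply: ltnW.
set n : R := m%:R; set s := Num.sqrt (\tr (N *m N)).
have n1 : 1 < n by rewrite ltr1n.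
have nz : n != 0 by rewrite gt_eqF //; lra.
have n1z : n - 1 != 0 by rewrite gt_eqF // subr_gt0.
set sg := Num.sqrt _.
have nn0 : 0 < n * (n - 1) by rewrite mulr_gt0 ?subr_gt0 //; lra.
have sg2 : sg ^+ 2 = n * (n - 1) by rewrite sqr_sqrtr // ltW.
have sg0 : 0 < sg by rewrite sqrtr_gt0.
have s2 : \tr (N *m N) = s ^+ 2 by rewrite sqr_sqrtr // trace_mul_sym_ge0.
have s0 : 0 <= s by rewrite sqrtr_ge0.
pose al := s / sg; pose be := s * (n - 1) / sg.
pose X := N - al%:M.
have lower (w : 'rV[R]_m) : 0 <= (w *m (N + be%:M) *m w^T) 0 0.
  rewrite mulmxDr mulmxDl mul_mx_scalar -scalemxAl !mx_linE.
  have := tracefree_form_bound w m0 sN trN; rewrite s2.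
  set x := (w *m N *m w^T) 0 0; set r := (w *m w^T) 0 0 => xr.
  have r0 : 0 <= r.
    by rewrite /r mxE; apply: sumr_ge0 => i _; rewrite mxE -expr2 sqr_ge0.
  have be0 : 0 <= be by rewrite /be divr_ge0 ?mulr_ge0 ?(ltW sg0) // subr_ge0 ltW.
  have : x ^+ 2 <= (be * r) ^+ 2.
    apply: le_trans xr _; rewrite /be !exprMn exprVn sg2.
    suff -> : s ^+ 2 * (r ^+ 2 * ((m%:R - 1) / m%:R))
      = s ^+ 2 * (n - 1) ^+ 2 / (n * (n - 1)) * r ^+ 2 by [].
    by rewrite -/n; field; rewrite nz n1z.
  rewrite -[x ^+ 2]real_normK ?num_real // ler_pXn2r ?nnegrE ?(mulr_ge0 be0 r0) //.
  by rewrite ler_norml => /andP[+ _]; lra.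
have : 0 <= \tr (X *m (N + be%:M) *m X^T).
  apply: sumr_ge0 => i _; have := lower (row i X); congr (0 <= _).
  by rewrite tr_row -row_mul [RHS]mxE [LHS]mxE; apply: eq_bigr => j _; rewrite !mxE.
have XT : X^T = X by rewrite /X linearB /= sN tr_scalar_mx.
have -> : \tr (X *m (N + be%:M) *m X^T)
    = \tr (N *m N *m N) + (be - 2 * al) * s ^+ 2 + n * (al ^+ 2 * be).
  rewrite XT -s2 /X -[al%:M]scalemx1 -[be%:M]scalemx1.
  rewrite !(mulmxDl, mulmxDr, mulmxN, mulNmx) -!(scalemxAl, scalemxAr).
  rewrite !(mulmx1, mul1mx) -?(scalemxAl, scalemxAr).
  rewrite !(raddfD, raddfN) /= !mxtraceZ trN mxtrace1 -/n.
  by ring.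
suff -> : (n - 2) / sg * s ^+ 3 = (be - 2 * al) * s ^+ 2 + n * (al ^+ 2 * be) by lra.
have sgn0 : sg != 0 by rewrite gt_eqF.
have -> : n * (al ^+ 2 * be) = n * (n - 1) * (s ^+ 3 / sg ^+ 3).
  by rewrite /al /be; field.
by rewrite -sg2 /al /be; field.
Qed.

Section MetricTraces.
Context {m : nat} {G : 'M[R]_m}.
Hypotheses (GT : G^T = G) (G0 : posdef G).

Lemma posdef_inv : exists Q : 'M[R]_m, invmx G = Q^T *m Q.
Proof.
have [Q QGQ] := posdef_orthonormal_basis GT G0; exists Q.
have eq1 : Q^T *m Q *m G = 1%:M by rewrite -mulmxA; apply: mulmx1C.
have [_ uG] := mulmx1_unit eq1.
by rewrite -[RHS]mulmx1 -(mulmxV uG) mulmxA eq1 mul1mx.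
Qed.

(** In an orthonormal basis of the metric the endomorphism becomes a symmetric
    matrix with the same traces. *)
Lemma okumura (T : 'M[R]_m) (N := invmx G *m T) : (1 < m)%N ->
  T^T = T -> \tr N = 0 ->
  - ((m%:R - 2) / Num.sqrt (m%:R * (m%:R - 1)) * Num.sqrt (\tr (N *m N)) ^+ 3)
    <= \tr (N *m N *m N).
Proof.
move=> m1 sT; rewrite /N; have [Q ->] := posdef_inv => trN.
have sN : (Q *m T *m Q^T)^T = Q *m T *m Q^T by rewrite !trmx_mul trmxK sT mulmxA.
have := okumura_sym m1 sN; rewrite [\tr (_ *m T *m _)]mxtrace_mulC !mulmxA.
move=> /(_ trN); rewrite [\tr (_ *m Q^T)]mxtrace_mulC !mulmxA => le.
by rewrite [\tr (_ *m Q^T)]mxtrace_mulC !mulmxA in le.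
Qed.

Lemma trace_selfadj_sq_ge0 (T : 'M[R]_m) (N := invmx G *m T) :
  T^T = T -> 0 <= \tr (N *m N).
Proof.
move=> sT; rewrite /N; have [Q ->] := posdef_inv.
have sN : (Q *m T *m Q^T)^T = Q *m T *m Q^T by rewrite !trmx_mul trmxK sT mulmxA.
have := trace_mul_sym_ge0 sN.
by rewrite !mulmxA [\tr (_ *m Q^T)]mxtrace_mulC !mulmxA.
Qed.

(** Writing the inverse metric as [Q^T Q] makes the expression a sum over p of
    traces of squares of self-adjoint endomorphisms. *)
Lemma sqnorm_differential_ge0 (T : 'I_m -> 'M[R]_m) :
  (forall i, (T i)^T = T i) ->
  0 <= \sum_i \sum_k invmx G i k * \tr (invmx G *m T i *m (invmx G *m T k)).
Proof.
move=> sT; have [Q QE] := posdef_inv.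
have -> : \sum_i \sum_k invmx G i k * \tr (invmx G *m T i *m (invmx G *m T k))
    = \sum_p \tr (invmx G *m (\sum_i Q p i *: T i) *m
                   (invmx G *m (\sum_i Q p i *: T i))).
  under [in RHS]eq_bigr => p _.
    rewrite mulmx_sumr mulmx_suml linear_sum /=.
    under eq_bigr => i _.
      rewrite mulmx_sumr linear_sum /=.
      under eq_bigr => k _ do
        rewrite -!scalemxAr -scalemxAl !linearZ /= mulrA.
      over.
    over.
  rewrite [RHS]exchange_big; apply: eq_bigr => i _ /=.
  rewrite [RHS]exchange_big; apply: eq_bigr => k _ /=.
  rewrite -mulr_suml; congr (_ * _); rewrite QE mxE.
  by apply: eq_bigr => p _; rewrite mxE mulrC.
apply: sumr_ge0 => p _; apply: trace_selfadj_sq_ge0.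
by rewrite linear_sum; apply: eq_bigr => i _; rewrite linearZ /= sT.
Qed.

End MetricTraces.

End Okumura.

Local Open Scope classical_set_scope.
Local Open Scope ring_scope.

(** * Smooth functions of several variables *)

Lemma near_eq_differentiable (K : numFieldType) (V W : normedModType K)
    (u w : V -> W) (x : V) :
  (\near x, u x = w x) -> differentiable u x -> differentiable w x.
Proof.
move=> uw /diff_locallyP[cdu /eqaddoP du].
have near0 : \forall h \near (0 : V), u (h + x) = w (h + x).
  have := uw; rewrite (near_shift 0 x).
  by apply: filterS => h /=; rewrite !subr0.
have ux : u x = w x := nbhs_singleton uw.
have dw : w \o shift x = cst (w x) + 'd u x +o_ 0 id.
  apply/eqaddoP => e e0; apply: filterS2 near0 (du e e0) => h uwh.
  have -> : (w \o shift x - (cst (w x) + 'd u x)) h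
      = (u \o shift x - (cst (u x) + 'd u x)) h.
    by rewrite -[LHS]/(w (h + x) - (w x + 'd u x h)) -uwh -ux.
  by [].
have duw := diff_unique cdu dw.
by apply/diff_locallyP; rewrite duw.
Qed.

Section SecondDerivatives.
Context {R : realType} {W : normedModType R}.
Implicit Types (u : W -> R) (x a b : W).

(** The difference quotients of both sides are the same functions. *)
Lemma is_derive_line u x a (s : R) : differentiable u (x + s *: a) ->
  is_derive s 1 (fun t => u (x + t *: a)) ('D_a u (x + s *: a)).
Proof.
move=> du.
have eqf : (fun h : R => h^-1 *: (((fun t => u (x + t *: a)) \o shift s) (h *: 1)
      - u (x + s *: a)))
    = (fun h => h^-1 *: ((u \o shift (x + s *: a)) (h *: a) - u (x + s *: a))).
  apply/funext => h /=; congr (_ *: (u _ - _)).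
  by rewrite [h *: 1]mulr1 scalerDl addrCA addrA.
apply: DeriveDef.
  by rewrite /derivable eqf; exact: diff_derivable.
by rewrite /derive eqf.
Qed.

Lemma line_MVT u x a (h : R) : 0 < h ->
  (forall s, 0 <= s <= h -> differentiable u (x + s *: a)) ->
  exists2 s, 0 <= s <= h & u (x + h *: a) - u x = 'D_a u (x + s *: a) * h.
Proof.
move=> h0 du.
have [|||s] := @MVT R (fun t => u (x + t *: a)) (fun t => 'D_a u (x + t *: a)) 0 h.
- by [].
- move=> s; rewrite in_itv /= => /andP[s0 sh]; apply: is_derive_line.
  by apply: du; rewrite !ltW.
- apply: derivable_within_continuous => s; rewrite in_itv /= => sh.
  by have [] := is_derive_line (du s sh).
rewrite in_itv /= => /andP[s0 sh]; rewrite scale0r addr0 subr0 => eqs.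
by exists s; rewrite // !ltW.
Qed.

Lemma derive_translate u x a (c : W) :
  'D_a (fun y => u (y + c)) x = 'D_a u (x + c).
Proof.
have eqf : (fun h : R =>
      h^-1 *: (((fun y => u (y + c)) \o shift x) (h *: a) - u (x + c)))
    = (fun h => h^-1 *: ((u \o shift (x + c)) (h *: a) - u (x + c))).
  by apply/funext => h /=; rewrite addrA.
by rewrite /derive eqf.
Qed.

Lemma differentiable_translate u x (c : W) :
  differentiable u (x + c) -> differentiable (fun y => u (y + c)) x.
Proof.
move=> du; apply: (@differentiable_comp _ _ _ _ (fun y : W => y + c) u) => //.
Qed.

Definition second_difference u x a b (h : R) : R :=
  u (x + h *: a + h *: b) - u (x + h *: a) - (u (x + h *: b) - u x).

(** The mean value theorem along [a] for the increment of [u] in direction [b],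
    then along [b] for the derivative in direction [a]. *)
Lemma second_difference_MVT u x a b (h : R) : 0 < h ->
  (forall s t, 0 <= s <= h -> 0 <= t <= h ->
     differentiable u (x + s *: a + t *: b) /\
     differentiable ('D_a u) (x + s *: a + t *: b)) ->
  exists s t, [/\ 0 <= s <= h, 0 <= t <= h &
    second_difference u x a b h = 'D_b ('D_a u) (x + s *: a + t *: b) * h ^+ 2].
Proof.
move=> h0 du.
pose w y := u (y + h *: b) - u y.
have d0 s : 0 <= s <= h ->
    differentiable u (x + s *: a) /\ differentiable u (x + s *: a + h *: b).
  move=> sh; have h0h : 0 <= h <= h by rewrite lexx ltW.
  have [|du0 _] := du s 0 sh; first by rewrite lexx ltW.
  by have [duh _] := du s h sh h0h; rewrite scale0r addr0 in du0.
have [s sh|s sh eqs] := @line_MVT w x a h h0.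
  have [du0 duh] := d0 s sh.
  by apply: differentiableB => //; apply: differentiable_translate.
have [|t th eqt] := @line_MVT ('D_a u) (x + s *: a) b h h0.
  by move=> t th; have [] := du s t sh th.
exists s, t; split=> //.
rewrite [LHS]eqs; have [du0 duh] := d0 s sh.
rewrite /w deriveB; first last.
- exact: diff_derivable.
- by apply: diff_derivable; apply: differentiable_translate.
by rewrite derive_translate eqt expr2 mulrA.
Qed.

(** A second difference that is, on arbitrarily small squares, a value of [P] and
    a value of [Q] times the area forces [P x = Q x] by continuity. *)
Lemma eq_of_small_squares (D : R -> R) (P Q : W -> R) x a b (A : set W) :
  nbhs x A -> {for x, continuous P} -> {for x, continuous Q} ->
  (forall h, 0 < h ->
     (forall s t, 0 <= s <= h -> 0 <= t <= h -> A (x + s *: a + t *: b)) ->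
     (exists s t, [/\ 0 <= s <= h, 0 <= t <= h &
        D h = P (x + s *: a + t *: b) * h ^+ 2]) /\
     (exists s t, [/\ 0 <= s <= h, 0 <= t <= h &
        D h = Q (x + s *: a + t *: b) * h ^+ 2])) ->
  P x = Q x.
Proof.
move=> Ax cP cQ mvt.
apply/eqP; rewrite -subr_eq0 -normr_le0; apply/ler_addgt0Pr => e e0; rewrite add0r.
have e2 : 0 < e / 2 by rewrite divr_gt0.
have HP : \forall y \near x, `|P x - P y| < e / 2.
  by move/cvgrPdist_lt : cP => /(_ _ e2).
have HQ : \forall y \near x, `|Q x - Q y| < e / 2.
  by move/cvgrPdist_lt : cQ => /(_ _ e2).
have near_all : nbhs x (A `&` ([set y | `|P x - P y| < e / 2]
    `&` [set y | `|Q x - Q y| < e / 2])) by do 2!apply: filterI => //.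
have [r /= r0 near_r] := (nbhs_ballP x _).1 near_all.
pose K := `|a| + `|b| + 1.
have K0 : 0 < K by rewrite ltr_wpDl // addr_ge0.
pose h := r / K.
have h0 : 0 < h by rewrite divr_gt0.
have square s t : 0 <= s <= h -> 0 <= t <= h -> ball x r (x + s *: a + t *: b).
  move=> /andP[s0 sh] /andP[t0 th]; rewrite -ball_normE /= -addrA opprD addNKr normrN.
  apply: le_lt_trans (ler_normD _ _) _; rewrite !normrZ !ger0_norm //.
  have : s * `|a| + t * `|b| <= h * (K - 1).
    by rewrite /K addrK mulrDr lerD // ler_wpM2r.
  move=> /le_lt_trans; apply.
  by rewrite mulrBr mulr1 /h divfK ?gt_eqF // ltrBlDr ltrDl.
have [|[s [t [sh th eqP']]] [s' [t' [sh' th' eqQ]]]] := mvt h h0.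
  by move=> s t sh th; have [] := near_r _ (square s t sh th).
have PQ : P (x + s *: a + t *: b) = Q (x + s' *: a + t' *: b).
  by apply: (@mulIf _ (h ^+ 2)); [rewrite expf_eq0 /= gt_eqF | rewrite -eqP'].
have [_ [HP' _]] := near_r _ (square s t sh th).
have [_ [_ HQ']] := near_r _ (square s' t' sh' th').
have -> : P x - Q x
    = (P x - P (x + s *: a + t *: b)) - (Q x - Q (x + s' *: a + t' *: b)).
  by rewrite PQ; ring.
apply: le_trans (ler_normB _ _) _; rewrite [leRHS]splitr.
by apply: lerD; apply: ltW.
Qed.

(** Schwarz's theorem: the second difference is symmetric in the two
    directions. *)
Lemma mixed_derivatives_commute u x a b :
  (\near x, differentiable u x) ->
  (\near x, differentiable ('D_a u) x) -> (\near x, differentiable ('D_b u) x) ->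
  {for x, continuous ('D_b ('D_a u))} -> {for x, continuous ('D_a ('D_b u))} ->
  'D_b ('D_a u) x = 'D_a ('D_b u) x.
Proof.
move=> du dau dbu cba cab.
have near_x : nbhs x ([set y | differentiable u y]
    `&` ([set y | differentiable ('D_a u) y] `&` [set y | differentiable ('D_b u) y])).
  by do 2!apply: filterI => //.
apply: (@eq_of_small_squares (second_difference u x a b) _ _ x a b _ near_x cba cab).
move=> h h0 diff_sq; split.
  apply: second_difference_MVT => // s t sh th.
  by have [? []] := diff_sq s t sh th.
have swap s t : x + s *: b + t *: a = x + t *: a + s *: b by rewrite addrAC.
have [|s [t [sh th eqs]]] := @second_difference_MVT u x b a h h0.
  by move=> s t sh th; rewrite swap; have [? []] := diff_sq t s th sh.
exists t, s; rewrite -swap; split; [exact: th | exact: sh |].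
by rewrite -eqs /second_difference swap; ring.
Qed.

End SecondDerivatives.

Section SmoothFunctions.
Context {R : realType} {m : nat} (V : set 'rV[R]_m) (oV : open V).
Implicit Types (i j : 'I_m) (u w : 'rV[R]_m -> R) (x : 'rV[R]_m).

Lemma near_eq_on u w x : V x -> (forall y, V y -> u y = w y) -> \near x, u x = w x.
Proof.
move=> Vx uw; have Vnear : nbhs x V by exact: open_nbhs_nbhs.
by apply: filterS Vnear => y Vy; apply: uw.
Qed.

Lemma partial_eq_on i u w x : V x -> (forall y, V y -> u y = w y) ->
  partial i u x = partial i w x.
Proof. by move=> Vx uw; apply: near_eq_derive; exact: near_eq_on. Qed.

Lemma continuous_eq_on u w x : V x -> (forall y, V y -> u y = w y) ->
  {for x, continuous u} -> {for x, continuous w}.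
Proof.
move=> Vx uw cu; rewrite /prop_for /continuous_at.
rewrite -(uw x) //; apply: cvg_trans cu.
exact: near_eq_cvg (near_eq_on Vx uw).
Qed.

Lemma differentiable_eq_on u w x : V x -> (forall y, V y -> u y = w y) ->
  differentiable u x -> differentiable w x.
Proof.
move=> Vx uw; apply: near_eq_differentiable; exact: near_eq_on.
Qed.

Lemma partial_differentiable i u x : differentiable u x -> derivable u x (delta_mx 0 i).
Proof. exact: diff_derivable. Qed.

Lemma Ck_eq_on k u w : (forall x, V x -> u x = w x) -> Ck_on k V u -> Ck_on k V w.
Proof.
elim: k u w => [|k IH] u w uw /=.
  by move=> cu x Vx; apply: continuous_eq_on (cu x Vx).
case=> du pu; split=> [x Vx|i]; first exact: differentiable_eq_on (du x Vx).
apply: IH (pu i) => x Vx; exact: partial_eq_on.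
Qed.

Lemma CkW k u : Ck_on k.+1 V u -> Ck_on k V u.
Proof.
elim: k u => [|k IH] u /= [du pu].
  by move=> x /du; exact: differentiable_continuous.
by split=> // i; apply: IH.
Qed.

Lemma Ck_cst k (c : R) : Ck_on k V (cst c).
Proof.
elim: k c => [|k IH] c /=; first by move=> x _; exact: cst_continuous.
split=> [x _|i]; first exact: differentiable_cst.
apply: Ck_eq_on (IH 0) => x _; by rewrite /partial derive_cst.
Qed.

Lemma CkD k u w : Ck_on k V u -> Ck_on k V w -> Ck_on k V (u + w).
Proof.
elim: k u w => [|k IH] u w /=.
  by move=> cu cw x Vx; apply: continuousD; [exact: cu | exact: cw].
move=> [du pu] [dw pw]; split=> [x Vx|i].
  by apply: differentiableD; [exact: du | exact: dw].
apply: Ck_eq_on (IH _ _ (pu i) (pw i)) => x Vx.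
by rewrite /partial deriveD //; apply: partial_differentiable; [exact: du | exact: dw].
Qed.

Lemma CkM k u w : Ck_on k V u -> Ck_on k V w -> Ck_on k V (u * w).
Proof.
elim: k u w => [|k IH] u w.
  by move=> cu cw x Vx; apply: continuousM; [exact: cu | exact: cw].
move=> Cu Cw; have Cu' := CkW Cu; have Cw' := CkW Cw.
case: Cu Cw => du pu [dw pw]; split=> [x Vx|i].
  by apply: differentiableM; [exact: du | exact: dw].
apply: Ck_eq_on (CkD (IH _ _ Cu' (pw i)) (IH _ _ Cw' (pu i))) => x Vx.
by rewrite /partial deriveM //; apply: partial_differentiable; [exact: du | exact: dw].
Qed.

Lemma CkN k u : Ck_on k V u -> Ck_on k V (- u).
Proof.
move=> Cu; apply: Ck_eq_on (CkM (Ck_cst k (-1)) Cu) => x _.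
by rewrite [LHS]mulN1r.
Qed.

Lemma CkV k u : (forall x, V x -> u x != 0) -> Ck_on k V u ->
  Ck_on k V (fun x => (u x)^-1).
Proof.
move=> u0; elim: k => [|k IH].
  by move=> cu x Vx; apply: continuousV; [exact: u0 | exact: cu].
move=> Cu; have Ciu := IH (CkW Cu); case: Cu => du pu; split=> [x Vx|i].
  apply: (@differentiable_comp _ _ _ _ u (fun y => y^-1)); first exact: du.
  by apply/derivable1_diffP; apply: derivableV => //; exact: u0.
apply: Ck_eq_on (CkN (CkM (CkM Ciu Ciu) (pu i))) => x Vx.
rewrite /partial deriveV; [|exact: u0|by apply: partial_differentiable; exact: du].
by rewrite expr2 invfM [RHS]mulNr.
Qed.

Lemma partial_exp i u x : differentiable u x ->
  partial i (fun y => expR (u y)) x = expR (u x) * partial i u x.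
Proof.
move=> du; have de : differentiable (@expR R) (u x).
  by apply/derivable1_diffP; exact: derivable_expR.
rewrite /partial deriveE; last exact: (@differentiable_comp _ _ _ _ u expR).
rewrite (@diff_comp _ _ _ _ u expR) //= diff1E // derive1E derive_val.
by rewrite deriveE // mulrC.
Qed.

Lemma Ck_exp k u : Ck_on k V u -> Ck_on k V (fun x => expR (u x)).
Proof.
elim: k => [|k IH].
  move=> cu x Vx; apply: (@continuous_comp _ _ _ u expR); first exact: cu.
  exact: continuous_expR.
move=> Cu; have Ceu := IH (CkW Cu); case: Cu => du pu; split=> [x Vx|i].
  apply: (@differentiable_comp _ _ _ _ u expR); first exact: du.
  by apply/derivable1_diffP; exact: derivable_expR.
apply: Ck_eq_on (CkM Ceu (pu i)) => x Vx.
by rewrite partial_exp //; exact: du.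
Qed.

End SmoothFunctions.

(** * The ring of smooth functions on an open set *)

(** An open set with a base point. The base point fixes the values outside the
    open set of the functions representing elements of [smooth_ring]. *)
Record pointed_open (R : realType) (m : nat) := PointedOpen {
  po_set : set 'rV[R]_m;
  po_open : open po_set;
  po_pt : 'rV[R]_m;
  po_in : po_set po_pt
}.

Arguments po_open {R m} p.
Arguments po_in {R m} p.

Section SmoothRing.
Context {R : realType} {m : nat} (O : pointed_open R m).
Local Notation V := (po_set O).
Implicit Types (i j : 'I_m) (u w : 'rV[R]_m -> R) (x y : 'rV[R]_m).

(** The value taken outside V is prescribed, so that two elements of the ring are
    equal as soon as they agree on V. *)
Definition smooth_fct : {pred 'rV[R]_m -> R} :=
  fun u => `[< smooth_on V u /\ forall y, ~ V y -> u y = u (po_pt O) >].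

Lemma smooth_fctP u : reflect
  (smooth_on V u /\ forall y, ~ V y -> u y = u (po_pt O)) (u \in smooth_fct).
Proof. exact: asboolP. Qed.

Lemma smooth_fct_subring : subring_closed smooth_fct.
Proof.
have oV := po_open O.
split=> [|u w /smooth_fctP[su cu] /smooth_fctP[sw cw]
         |u w /smooth_fctP[su cu] /smooth_fctP[sw cw]].
- by apply/smooth_fctP; split=> // k; exact: (Ck_cst oV).
- apply/smooth_fctP; split=> [k|y Vy].
    exact: (CkD oV (su k) (CkN oV (sw k))).
  by rewrite -[LHS]/(u y - w y) cu // cw.
- apply/smooth_fctP; split=> [k|y Vy]; first exact: (CkM oV (su k) (sw k)).
  by rewrite -[LHS]/(u y * w y) cu // cw.
Qed.

HB.instance Definition _ := GRing.isSubringClosed.Build _ smooth_fct smooth_fct_subring.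

Record smooth_ring := SmoothRing {
  smooth_val :> 'rV[R]_m -> R;
  _ : smooth_val \in smooth_fct
}.

HB.instance Definition _ := [isSub for smooth_val].
HB.instance Definition _ := [Choice of smooth_ring by <:].
HB.instance Definition _ := [SubChoice_isSubComNzRing of smooth_ring by <:].

Lemma smooth_ringP (a : smooth_ring) :
  smooth_on V a /\ forall y, ~ V y -> a y = a (po_pt O).
Proof. by apply/smooth_fctP; case: a. Qed.

Lemma smooth_ring_eq (a b : smooth_ring) : (forall y, V y -> a y = b y) -> a = b.
Proof.
move=> ab; apply: val_inj; apply/funext => y /=.
have [Vy|nVy] := pselect (V y); first exact: ab.
rewrite (smooth_ringP a).2 // (smooth_ringP b).2 //; apply: ab; exact: po_in.
Qed.

Definition extend u y := if `[< V y >] then u y else u (po_pt O).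

Lemma extendE u y : V y -> extend u y = u y.
Proof. by rewrite /extend; case: asboolP. Qed.

Lemma extend_smooth u : smooth_on V u -> extend u \in smooth_fct.
Proof.
move=> su; apply/smooth_fctP; split=> [k|y nVy].
  by apply: (Ck_eq_on (po_open O) _ (su k)) => y Vy; rewrite extendE.
rewrite [RHS]extendE; last exact: po_in.
by rewrite /extend; case: asboolP.
Qed.

Definition smooth_elt u (su : smooth_on V u) : smooth_ring :=
  SmoothRing (extend_smooth su).

Lemma smooth_eltE u (su : smooth_on V u) y : V y -> smooth_elt su y = u y.
Proof. exact: extendE. Qed.

Lemma smooth_partial i u : smooth_on V u -> smooth_on V (partial i u).
Proof. by move=> su k; have [_] := su k.+1; apply. Qed.

Definition smooth_der i (a : smooth_ring) : smooth_ring :=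
  smooth_elt (smooth_partial i (smooth_ringP a).1).

Lemma smooth_differentiable (a : smooth_ring) y : V y -> differentiable a y.
Proof. by move=> Vy; have [+ _] := (smooth_ringP a).1 1%N; apply. Qed.

Lemma smooth_derE i (a : smooth_ring) y : V y -> smooth_der i a y = partial i a y.
Proof. exact: smooth_eltE. Qed.

Lemma smooth_derD i (a b : smooth_ring) :
  smooth_der i (a + b) = smooth_der i a + smooth_der i b.
Proof.
apply: smooth_ring_eq => y Vy; rewrite -[RHS]/(smooth_der i a y + smooth_der i b y).
rewrite !smooth_derE // /partial -deriveD //.
- by apply: diff_derivable; exact: smooth_differentiable.
- by apply: diff_derivable; exact: smooth_differentiable.
Qed.

Lemma smooth_derM i (a b : smooth_ring) :
  smooth_der i (a * b) = smooth_der i a * b + a * smooth_der i b.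
Proof.
apply: smooth_ring_eq => y Vy.
rewrite -[RHS]/(smooth_der i a y * b y + a y * smooth_der i b y).
rewrite !smooth_derE // /partial (@deriveM _ _ a b).
- by rewrite addrC mulrC.
- by apply: diff_derivable; exact: smooth_differentiable.
- by apply: diff_derivable; exact: smooth_differentiable.
Qed.

Lemma smooth_derC i j (a : smooth_ring) :
  smooth_der i (smooth_der j a) = smooth_der j (smooth_der i a).
Proof.
apply: smooth_ring_eq => y Vy; have oV := po_open O.
have der2 i' j' : smooth_der i' (smooth_der j' a) y = partial i' (partial j' a) y.
  apply: etrans (smooth_derE i' _ Vy) _.
  by apply: (partial_eq_on oV) => // z Vz; exact: smooth_derE.
rewrite !der2.
have nearV : nbhs y V by exact: open_nbhs_nbhs.
have sa := (smooth_ringP a).1.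
have near_diff u : smooth_on V u -> \near y, differentiable u y.
  by move=> su; apply: filterS nearV => z Vz; have [+ _] := su 1%N; apply.
apply: mixed_derivatives_commute.
- exact: near_diff.
- by apply: near_diff; exact: smooth_partial.
- by apply: near_diff; exact: smooth_partial.
- exact: (smooth_partial i (smooth_partial j sa) 0%N).
- exact: (smooth_partial j (smooth_partial i sa) 0%N).
Qed.

Definition smooth_derivations : derivations smooth_ring m :=
  Derivations smooth_derD smooth_derM smooth_derC.

Definition smooth_ev y (a : smooth_ring) : R := a y.

Arguments smooth_ev : simpl never.

Lemma smooth_ev_additive y : additive (smooth_ev y).
Proof. by []. Qed.
Lemma smooth_ev_mult y : multiplicative (smooth_ev y).
Proof. by []. Qed.

HB.instance Definition _ y :=
  GRing.isAdditive.Build smooth_ring R (smooth_ev y) (smooth_ev_additive y).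
HB.instance Definition _ y :=
  GRing.isMultiplicative.Build smooth_ring R (smooth_ev y) (smooth_ev_mult y).

Lemma smooth_inverse (a : smooth_ring) :
  (forall y, V y -> smooth_ev y a != 0) -> exists b, a * b = 1.
Proof.
move=> a0; have su : smooth_on V (fun y => (a y)^-1).
  by move=> k; apply: (CkV (po_open O) a0); exact: (smooth_ringP a).1.
exists (smooth_elt su); apply: smooth_ring_eq => y Vy.
by rewrite -[LHS]/(a y * smooth_elt su y) smooth_eltE // divff ?a0.
Qed.

End SmoothRing.

(** * Coordinate expressions as evaluations *)

Section Evaluation.
Context {R : realType} {m : nat} (O : pointed_open R m).
Local Notation V := (po_set O).
Local Notation A := (smooth_ring O).
Local Notation d := (smooth_derivations O).
Local Notation ev := (@smooth_ev R m O).
Implicit Types (i j k l : 'I_m) (u f : 'rV[R]_m -> R) (y : 'rV[R]_m) (a b : A).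

(** The bridge from coordinate expressions, which are functions on the whole of
    R^m with junk values outside V, to elements of the ring. *)
Definition represents u a := forall y, V y -> u y = ev y a.
Definition represents_mx (F : 'rV[R]_m -> 'M[R]_m) (X : 'M[A]_m) :=
  forall y, V y -> F y = map_mx (ev y) X.

Lemma represents_elt u (su : smooth_on V u) : represents u (smooth_elt su).
Proof. by move=> y Vy; rewrite /smooth_ev smooth_eltE. Qed.

(** As V is open, derivatives on V depend only on the values on V. *)
Lemma represents_partial i u a : represents u a -> represents (partial i u) (d i a).
Proof.
move=> ua y Vy; apply: etrans (partial_eq_on (po_open O) i Vy ua) _.
by apply: esym; exact: smooth_derE.
Qed.

Lemma represents_entry F X i j :
  represents_mx F X -> represents (fun y => F y i j) (X i j).
Proof. by move=> FX y Vy; rewrite FX // mxE. Qed.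

Context {G : 'rV[R]_m -> 'M[R]_m} {g h : 'M[A]_m} {half : A}.
Hypothesis half2 : half * 2 = 1.
Hypothesis g_sym : g^T = g.
Hypothesis hg : h *m g = 1%:M.
Hypothesis Gg : represents_mx G g.

Local Notation C := (christoffel_mx d (half := half) g h).
Let lc : levi_civita d g h C := levi_civita_christoffel d half2 g_sym hg.

Let ev_half y : ev y half = 2^-1.
Proof.
have := congr1 (ev y) half2; rewrite rmorphM rmorph1 rmorph_nat => e.
have two0 : 2 != 0 :> R by rewrite pnatr_eq0.
by apply: (mulIf two0); rewrite e mulVf.
Qed.

Lemma represents_inv y : V y -> invmx (G y) = map_mx (ev y) h.
Proof.
move=> Vy; have e : map_mx (ev y) h *m G y = 1%:M.
  by rewrite Gg // -map_mxM hg map_mx1.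
have [_ uG] := mulmx1_unit e.
by rewrite -[RHS]mulmx1 -(mulmxV uG) mulmxA e mul1mx.
Qed.

Lemma represents_christoffel k i j : represents (christoffel G k i j) (C i k j).
Proof.
move=> y Vy; rewrite /christoffel mxE rmorphM /= ev_half rmorph_sum; congr (_ * _).
apply: eq_bigr => l _; rewrite represents_inv // mxE rmorphM; congr (_ * _).
rewrite rmorphB rmorphD.
by rewrite !(represents_partial _ (represents_entry _ _ Gg)).
Qed.

Lemma represents_riemann l i j k : represents (riemann G l i j k) (curv d C i j l k).
Proof.
move=> y Vy; rewrite /riemann.
rewrite !(represents_partial _ (represents_christoffel _ _ _) Vy).
rewrite /curv !mx_linE -addrA rmorphD rmorphB; congr (_ - _ + _).
- by rewrite [dmx _ _ _ _ _]mxE.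
- by rewrite [dmx _ _ _ _ _]mxE.
rewrite -mx_linE -mx_linE !mxE -sumrB rmorph_sum; apply: eq_bigr => p _.
rewrite [X in X - _]mulrC [X in _ - X]mulrC.
by rewrite !represents_christoffel // -!rmorphM -rmorphB.
Qed.

Lemma represents_ricci : represents_mx (ricci G) (ricci_mx d C).
Proof.
move=> y Vy; apply/matrixP => j k; rewrite !mxE rmorph_sum.
by apply: eq_bigr => i _; exact: represents_riemann.
Qed.

Lemma represents_hessian u a : represents u a ->
  represents_mx (hessian G u) (hess d C a).
Proof.
move=> ua y Vy; apply/matrixP => i j; rewrite !mxE rmorphB rmorph_sum.
rewrite (represents_partial i (represents_partial j ua) Vy); congr (_ - _).
apply: eq_bigr => k _; rewrite rmorphM.
by rewrite (represents_christoffel _ _ _ Vy) (represents_partial k ua Vy).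
Qed.

Lemma metric_trace_ev y (X : 'M[A]_m) : V y ->
  metric_trace G y (map_mx (ev y) X) = ev y (\tr (h *m X)).
Proof.
move=> Vy; rewrite /metric_trace represents_inv // /mxtrace rmorph_sum.
rewrite exchange_big; apply: eq_bigr => i _; rewrite mxE rmorph_sum.
apply: eq_bigr => j _; rewrite !mxE rmorphM.
by rewrite -[in RHS](lc_inv_sym lc) mxE.
Qed.

Lemma represents_scalar_curvature : represents (scalar_curvature G)
  (\tr (h *m ricci_mx d C)).
Proof.
by move=> y Vy; rewrite /scalar_curvature represents_ricci // metric_trace_ev.
Qed.

Lemma represents_laplacian u a : represents u a ->
  represents (laplacian G u) (lapl d h C a).
Proof.
by move=> ua y Vy; rewrite /laplacian (represents_hessian ua) // metric_trace_ev.
Qed.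

Lemma gradient_ev u a y : represents u a -> V y ->
  gradient G u y = (map_mx (ev y) (grad d h a))^T.
Proof.
move=> ua Vy; rewrite /gradient represents_inv // /grad map_mxM trmx_mul.
rewrite -[in LHS](lc_inv_sym lc); congr (_ *m _); last by rewrite -map_trmx.
by apply/matrixP => i j; rewrite !mxE (represents_partial _ ua).
Qed.

Lemma represents_drift_laplacian f u b a : represents f b -> represents u a ->
  represents (drift_laplacian G f u) (lapl d h C a - along d (grad d h b) a).
Proof.
move=> fb ua y Vy; rewrite /drift_laplacian (represents_laplacian ua) // rmorphB.
congr (_ - _); rewrite /inner_vec (gradient_ev fb) // (gradient_ev ua) // trmxK.
rewrite Gg // -mulmxA -map_mxM (raiseK lc) mxE rmorph_sum.
by apply: eq_bigr => i _; rewrite rmorphM !mxE.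
Qed.

(** Four contractions with the inverse metric are matrix products once [Y] is
    symmetric. *)
Lemma inner_tensor_ev y (X Y : 'M[A]_m) : V y -> Y^T = Y ->
  inner_tensor G y (map_mx (ev y) X) (map_mx (ev y) Y)
    = ev y (\tr (h *m X *m (h *m Y))).
Proof.
move=> Vy sY; rewrite /inner_tensor represents_inv //.
rewrite mulmxA /mxtrace rmorph_sum.
transitivity (\sum_k \sum_l \sum_j \sum_i ev y (h k i * X i j * h j l * Y l k)).
  under eq_bigr => i _ do rewrite exchange_big /=.
  rewrite exchange_big /=; apply: eq_bigr => k _.
  under eq_bigr => i _ do rewrite exchange_big /=.
  rewrite exchange_big /=; apply: eq_bigr => l _.
  rewrite exchange_big /=; apply: eq_bigr => j _; apply: eq_bigr => i _.
  have hC : h k i = h i k by rewrite -[in LHS](lc_inv_sym lc) mxE.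
  have YC : Y l k = Y k l by rewrite -[in LHS]sY mxE.
  rewrite hC YC !mxE -!rmorphM.
  by rewrite (mulrAC (h i k)).
apply: eq_bigr => k _; rewrite mxE rmorph_sum; apply: eq_bigr => l _.
rewrite mxE mulr_suml rmorph_sum; apply: eq_bigr => j _.
by rewrite mxE !mulr_suml rmorph_sum.
Qed.

Lemma represents_cov_deriv k T X : represents_mx T X ->
  represents_mx (cov_deriv G k T) (cov_deriv_mx d C k X).
Proof.
move=> TX y Vy; apply/matrixP => i j; rewrite mxE [RHS]mxE /cov_deriv_mx.
rewrite !mx_linE [dmx _ _ _ _ _]mxE rmorphB rmorphD.
rewrite (represents_partial k (represents_entry i j TX) Vy); congr (_ - _).
rewrite big_split /= [(_^T *m X) i j]mxE [(X *m _) i j]mxE !rmorph_sum.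
congr (_ + _); apply: eq_bigr => p _.
  have -> : (C k)^T i p = C k p i by rewrite [LHS]mxE.
  by rewrite represents_christoffel // (represents_entry p j TX) // -rmorphM.
rewrite [RHS]rmorphM [RHS]mulrC represents_christoffel //.
by rewrite (represents_entry i p TX).
Qed.

Lemma represents_sqnorm_cov_deriv T X : represents_mx T X -> X^T = X ->
  represents (sqnorm_cov_deriv G T) (\sum_k \sum_l h k l *
    \tr (cov_end d C k (h *m X) *m cov_end d C l (h *m X))).
Proof.
move=> TX sX y Vy; rewrite /sqnorm_cov_deriv rmorph_sum; apply: eq_bigr => k _.
rewrite rmorph_sum; apply: eq_bigr => l _.
rewrite !(represents_cov_deriv _ TX Vy) represents_inv // mxE rmorphM.
rewrite -!(raise_cov_deriv lc); congr (_ * _).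
exact: (inner_tensor_ev _ Vy (cov_deriv_mx_sym l sX)).
Qed.

End Evaluation.

(** * Gradient Ricci almost solitons *)

Lemma smooth_on_subset (R : realType) (m : nat) (V W : set 'rV[R]_m) u :
  V `<=` W -> smooth_on W u -> smooth_on V u.
Proof.
move=> VW su k; move: (su k) => {su}; elim: k u => [|k IH] u /=.
  by move=> cu x /VW; exact: cu.
by case=> du pu; split=> [x /VW|i]; [exact: du | exact: IH].
Qed.

Section LocalGeometry.
Context {R : realType} {m : nat} (O : pointed_open R m).
Local Notation V := (po_set O).
Local Notation A := (smooth_ring O).
Local Notation d := (smooth_derivations O).
Local Notation ev := (@smooth_ev R m O).

Lemma inverse_of_nat n : exists c : A, c * n.+1%:R = 1.
Proof.
have [b b1] : exists b : A, n.+1%:R * b = 1.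
  apply: smooth_inverse => y Vy.
  by rewrite rmorph_nat pnatr_eq0.
by exists b; rewrite mulrC.
Qed.

Definition lift_mx (F : 'rV[R]_m -> 'M[R]_m)
    (sF : forall i j, smooth_on V (fun y => F y i j)) : 'M[A]_m :=
  \matrix_(i, j) smooth_elt (sF i j).

Lemma represents_lift_mx (F : 'rV[R]_m -> 'M[R]_m)
    (sF : forall i j, smooth_on V (fun y => F y i j)) :
  represents_mx F (lift_mx sF).
Proof. by move=> y Vy; apply/matrixP => i j; rewrite !mxE; exact: represents_elt. Qed.

Lemma represents_mx_eq (X Y : 'M[A]_m) :
  (forall y, V y -> map_mx (ev y) X = map_mx (ev y) Y) -> X = Y.
Proof.
move=> XY; apply/matrixP => i j; apply: smooth_ring_eq => y Vy.
by have /matrixP/(_ i j) := XY y Vy; rewrite !mxE.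
Qed.

(** Cramer's rule, with the inverse of the nowhere vanishing determinant. *)
Lemma smooth_inverse_mx (g : 'M[A]_m) :
  (forall y, V y -> \det (map_mx (ev y) g) != 0) ->
  exists h : 'M[A]_m, h *m g = 1%:M.
Proof.
move=> det0; have [b gb] : exists b : A, \det g * b = 1.
  by apply: smooth_inverse => y Vy; rewrite -det_map_mx; exact: det0.
exists (b *: \adj g); rewrite -scalemxAl mul_adj_mx scale_scalar_mx.
by rewrite mulrC gb.
Qed.

Context {G : 'rV[R]_m -> 'M[R]_m} {F L u : 'rV[R]_m -> R}.
Hypothesis m3 : (3 <= m)%N.
Hypothesis G_smooth : forall i j, smooth_on V (fun y => G y i j).
Hypothesis G_sym : forall y, V y -> (G y)^T = G y.
Hypothesis G_pos : forall y, V y -> posdef (G y).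
Hypothesis F_smooth : smooth_on V F.
Hypothesis L_smooth : smooth_on V L.
Hypothesis u_smooth : smooth_on V u.
Hypothesis flat : forall y, V y -> forall l i j k,
  riemann (fun y => expR (2 * u y) *: G y) l i j k y = 0.
Hypothesis soliton : forall y, V y ->
  ricci G y + hessian G F y = L y *: G y.

Let n : R := m%:R.

Lemma soliton_formula_on_open y : V y ->
  let S := scalar_curvature G in
  let T := tracefree_ricci G in
  let normT2 := fun y => sqnorm_tensor G y (T y) in
  2^-1 * drift_laplacian G F normT2 y
    = sqnorm_cov_deriv G T y
      + 2 * (L y - S y * ((n - 2) / (n * (n - 1)))) * normT2 y
      + (n - 2) * inner_tensor G y (hessian G L y) (T y)
      + 4 / (n - 2) * trace_cube G y (T y)
  /\ [/\ \tr (invmx (G y) *m T y) = 0, (T y)^T = T y,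
       normT2 y = \tr (invmx (G y) *m T y *m (invmx (G y) *m T y)) &
       0 <= sqnorm_cov_deriv G T y].
Proof.
move=> Vy S T normT2.
have [half half2] := inverse_of_nat 1.
have [ninv ninvn] : exists c : A, c * m%:R = 1.
  by have := inverse_of_nat m.-1; rewrite prednK // (leq_trans _ m3).
pose g := lift_mx G_smooth; have Gg : represents_mx G g := represents_lift_mx G_smooth.
have g_sym : g^T = g.
  by apply: represents_mx_eq => z Vz; rewrite -map_trmx -Gg // G_sym.
have [h hg] : exists h : 'M[A]_m, h *m g = 1%:M.
  apply: smooth_inverse_mx => z Vz; rewrite -Gg //.
  apply/negP => /det0P[v v0 vG]; have := G_pos Vz v0.
  by rewrite vG mul0mx mxE ltxx.
pose C := christoffel_mx d (half := half) g h.
have lc : levi_civita d g h C := levi_civita_christoffel d half2 g_sym hg.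
pose ua : A := smooth_elt u_smooth; pose fa : A := smooth_elt F_smooth.
pose la : A := smooth_elt L_smooth.
have exp_smooth : smooth_on V (fun y => expR (2 * u y)).
  move=> k; apply: (Ck_exp (po_open O)).
  exact: (CkM (po_open O) (Ck_cst (po_open O) k 2) (u_smooth k)).
pose E : A := smooth_elt exp_smooth.
have [E' EE'] : exists E' : A, E * E' = 1.
  apply: smooth_inverse => z Vz; rewrite -(represents_elt exp_smooth Vz).
  by rewrite gt_eqF // expR_gt0.
have dE i : d i E = 2 * E * d i ua.
  apply: smooth_ring_eq => z Vz; rewrite [LHS]smooth_derE //.
  rewrite -[RHS]/(ev z 2 * ev z E * ev z (d i ua)) rmorph_nat.
  have Eu : represents (fun y => expR (2 * u y)) E := represents_elt exp_smooth.
  have uu : represents u ua := represents_elt u_smooth.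
  rewrite -(represents_partial i uu Vz) -(Eu z Vz).
  rewrite -(partial_eq_on (po_open O) i Vz Eu).
  have du : differentiable u z by have [+ _] := u_smooth 1%N; apply.
  rewrite (@partial_exp _ _ i (fun y => 2 * u y)); last exact: differentiableZ.
  have -> : partial i (fun y => 2 * u y) z = 2 * partial i u z.
    by apply: deriveZ; exact: diff_derivable.
  by ring.
have flatC i j : curv d (fun k => C k + ((d k ua)%:M + delta_mx k 0 *m (dcol d ua)^T
    - grad d h ua *m ((delta_mx k 0)^T *m g))) i j = 0.
  have GE : represents_mx (fun y => expR (2 * u y) *: G y) (E *: g).
    move=> z Vz; rewrite Gg // (represents_elt exp_smooth Vz).
    by apply/matrixP => a b; rewrite !mxE rmorphM.
  have gE : (E *: g)^T = E *: g by rewrite linearZ /= g_sym.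
  have hgE : (E' *: h) *m (E *: g) = 1%:M.
    by rewrite -scalemxAl -scalemxAr scalerA hg mulrC EE' scale1r.
  have -> : (fun k => C k + ((d k ua)%:M + delta_mx k 0 *m (dcol d ua)^T
    - grad d h ua *m ((delta_mx k 0)^T *m g)))
      = christoffel_mx d (half := half) (E *: g) (E' *: h).
    apply/funext => k; rewrite (christoffel_mx_conformal half2 g_sym hg EE' dE).
    by rewrite !addrA.
  apply/matrixP => l k; apply: smooth_ring_eq => z Vz.
  rewrite -[LHS]/(ev z _) -(represents_riemann half2 hgE GE) // flat //.
  by rewrite !mxE.
have cP := conformal_schouten_curv lc half2 flatC.
have cdP := conformal_schouten_codazzi lc half2 flatC.
have sP := conformal_schouten_selfadj (half := half) lc ua.
have sol : ricci_mx d C + hess d C fa = la *: g.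
  apply: represents_mx_eq => z Vz; rewrite map_mxD.
  rewrite -(represents_ricci half2 hg Gg) //.
  rewrite -(represents_hessian half2 hg Gg (represents_elt F_smooth)) //.
  rewrite soliton // (represents_elt L_smooth Vz) Gg //.
  by apply/matrixP => a b; rewrite !mxE rmorphM.
pose Tm := tracefree_ricci_mx d ninv g h C.
have ninvE z : ev z ninv = n^-1.
  have n0 : n != 0 by rewrite pnatr_eq0 -lt0n (leq_trans _ m3).
  by apply: (mulIf n0); rewrite mulVf // /n -(rmorph_nat (ev z)) -rmorphM ninvn rmorph1.
have SS := represents_scalar_curvature half2 g_sym hg Gg.
have TT : represents_mx T Tm.
  move=> z Vz; rewrite /T /tracefree_ricci /Tm /tracefree_ricci_mx map_mxB.
  rewrite -(represents_ricci half2 hg Gg) // SS //; congr (_ - _).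
  by rewrite map_mxZ -Gg // rmorphM /= ninvE mulrC.
have Tsym : Tm^T = Tm := tracefree_ricci_sym lc ninvn sP cP.
have trT := trace_tracefree_ricci lc ninvn sP cP.
have halfE : ev y half = 2^-1.
  have two0 : 2 != 0 :> R by rewrite pnatr_eq0.
  by apply: (mulIf two0); rewrite mulVf // -(rmorph_nat (ev y)) -rmorphM half2 rmorph1.
pose N := h *m Tm.
have normE : represents normT2 (\tr (N *m N)).
  move=> z Vz; rewrite /normT2 /sqnorm_tensor TT //.
  exact: (inner_tensor_ev half2 g_sym hg Gg _ Vz Tsym).
have FF : represents F fa := represents_elt F_smooth.
have LL : represents L la := represents_elt L_smooth.
have invE := represents_inv hg Gg Vy.
have NE : invmx (G y) *m T y = map_mx (ev y) N by rewrite invE TT // map_mxM.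
have DT := represents_sqnorm_cov_deriv half2 g_sym hg Gg TT Tsym Vy.
split; last split.
- have n1 : m%:R - 1 != 0 :> R.
    by rewrite subr_eq0 -[1]/(1%:R) eqr_nat neq_ltn (leq_trans _ m3) ?orbT.
  have n2 : m%:R - 2 != 0 :> R.
    by rewrite subr_eq0 eqr_nat neq_ltn m3 orbT.
  rewrite (represents_drift_laplacian half2 g_sym hg Gg FF normE) // -halfE.
  rewrite DT normE // (LL y Vy) /S (SS y Vy).
  rewrite (represents_hessian half2 hg Gg LL) // (TT y Vy).
  rewrite (inner_tensor_ev half2 g_sym hg Gg _ Vy Tsym).
  rewrite /trace_cube /endo invE -!map_mxM trace_map_mx -rmorphM.
  exact: (soliton_formula lc half2 ninvn sP cdP cP sol (ev y) n1 n2).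
- by rewrite NE trace_map_mx trT rmorph0.
- by rewrite TT // map_trmx Tsym.
- by rewrite NE normE // -map_mxM trace_map_mx.
have raiseE k : map_mx (ev y) h *m map_mx (ev y) (cov_deriv_mx d C k Tm)
    = map_mx (ev y) (cov_end d C k N) by rewrite -map_mxM (raise_cov_deriv lc).
rewrite DT rmorph_sum /=.
have := sqnorm_differential_ge0 (G_sym Vy) (G_pos Vy)
  (T := fun k => map_mx (ev y) (cov_deriv_mx d C k Tm)).
rewrite invE => /(_ _)/le_trans; apply=> [k|].
  by rewrite map_trmx (cov_deriv_mx_sym _ Tsym).
rewrite le_eqVlt; apply/orP; left; apply/eqP; apply: eq_bigr => k _.
rewrite rmorph_sum; apply: eq_bigr => l _; rewrite rmorphM.
congr (_ * _); first by rewrite mxE.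
transitivity (\tr (map_mx (ev y) (cov_end d C k N) *m map_mx (ev y) (cov_end d C l N))).
  by congr (\tr (_ *m _)); exact: raiseE.
by rewrite -map_mxM trace_map_mx.
Qed.

End LocalGeometry.

Theorem corollary2p7 (R : realType) (m : nat) (M : smoothManifold R m)
    (g : riemannianMetric M) (f lambda : M -> R) :
  (3 <= m)%N ->
  conformally_flat g ->
  gradient_ricci_almost_soliton g f lambda ->
  forall c, atlas c -> forall x, chart_img c x ->
  let G := g c in
  let F := f \o chart_inv c in
  let L := lambda \o chart_inv c in
  let S := scalar_curvature G in
  let T := tracefree_ricci G in
  let n : R := m%:R in
  let normT2 := fun y => sqnorm_tensor G y (T y) in
  2^-1 * drift_laplacian G F normT2 x
    = sqnorm_cov_deriv G T x
      + 2 * (L x - S x * ((n - 2) / (n * (n - 1)))) * normT2 x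
      + (n - 2) * inner_tensor G x (hessian G L x) (T x)
      + 4 / (n - 2) * trace_cube G x (T x)
  /\
  2^-1 * drift_laplacian G F normT2 x
    >= 2 * (L x - S x * ((n - 2) / (n * (n - 1)))) * normT2 x
       - 4 / Num.sqrt (n * (n - 1)) * norm_tensor G x (T x) ^+ 3
       + (n - 2) * inner_tensor G x (hessian G L x) (T x).
Proof.
move=> m3 cflat [f_smooth l_smooth sol] c ac x cx G F L S T n normT2.
have [U [u [oU Up u_smooth flat]]] := cflat (chart_inv c x).
(* the part of the chart image on which the conformal factor is defined *)
pose V := chart_map c @` (chart_dom c `&` U).
have VE : V = [set y | chart_img c y /\ U (chart_inv c y)].
  apply/seteqP; split=> [_ [p [cp pU] <-]|y [[p cp <-]]] /=.
    by rewrite chart_mapK //; split=> //; exists p.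
  by rewrite chart_mapK // => pU; exists p.
have V_img : V `<=` chart_img c by rewrite VE => y [].
have oV : open V.
  rewrite VE openE => y [cy Uy]; apply: filterI.
    by apply: open_nbhs_nbhs; split=> //; exact: chart_img_open.
  by apply: (chart_inv_continuous cy); exact: open_nbhs_nbhs.
have Vx : V x by rewrite VE.
have img_setT : chart_map c @` (chart_dom c `&` setT) = chart_img c.
  by rewrite setIT.
pose O := PointedOpen oV Vx.
have G_smooth i j : smooth_on V (fun y => G y i j).
  exact: smooth_on_subset V_img (metric_smooth g ac i j).
have F_smooth : smooth_on V F.
  by apply: smooth_on_subset V_img _; have := f_smooth c ac; rewrite img_setT.
have L_smooth : smooth_on V L.
  by apply: smooth_on_subset V_img _; have := l_smooth c ac; rewrite img_setT.
have G_sym y : V y -> (G y)^T = G y by move=> /V_img; exact: metric_sym.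
have G_pos y : V y -> posdef (G y) by move=> /V_img cy v; exact: metric_posdef.
have [formula [trT T_sym normE DT0]] :=
  @soliton_formula_on_open R m O G F L (u \o chart_inv c)
  m3 G_smooth G_sym G_pos F_smooth L_smooth (u_smooth c ac)
  (fun y Vy l i j k => flat c ac y Vy l i j k)
  (fun y Vy => sol c ac y (V_img y Vy)) x Vx.
split; first exact: formula.
rewrite formula.
have := okumura (G_sym x Vx) (G_pos x Vx) (ltnW m3) T_sym trT.
rewrite -normE -/(trace_cube G x (T x)) => cube_bound.
have n2 : 0 < n - 2 by rewrite subr_gt0 ltr_nat.
have le_cube : - (4 / Num.sqrt (n * (n - 1)) * norm_tensor G x (T x) ^+ 3)
    <= 4 / (n - 2) * trace_cube G x (T x).
  have := ler_wpM2l (ltW (divr_gt0 (ltr0n R 4) n2)) cube_bound.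
  by rewrite mulrN !mulrA divfK ?gt_eqF.
apply: (@le_trans _ _ (2 * (L x - S x * ((n - 2) / (n * (n - 1)))) * normT2 x
    + (n - 2) * inner_tensor G x (hessian G L x) (T x)
    + 4 / (n - 2) * trace_cube G x (T x))).
  by rewrite [leLHS]addrAC lerD2l; exact: le_cube.
by rewrite -!addrA lerDr.
Qed.
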